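(* (i) For every commutative $\mathbb{Q}$-algebra $R$, the additive group $\mathbb{G}_a^{\mathbb{N}}(R)=(R^{\mathbb{N}},+)$ and the group $(\mathfrak{G}^1_+(R),\boxtimes)$ are isomorphic. (ii) Let $k$ be a nonzero commutative unital ring. For every integer $s\ge 2$, the group-valued functors $(\mathfrak{G}^s_+,\boxtimes)$ and $\mathbb{G}_a^{\mathbb{N}}$ on commutative unital $k$-algebras are not isomorphic (the first one is not commutative).
   Context: Words: $[s]=\{1,\dots,s\}$; a word $w=(i_1\dots i_n)$ has length $|w|=n$. For a commutative unital ring $R$, $R_+\langle\langle z_1,\dots,z_s\rangle\rangle$ is the set of formal power series in $s$ non-commuting variables with zero constant term, $f=\sum_{|w|\ge1}X_w(f)z_w$, $z_w=z_{i_1}\cdots z_{i_n}$. $\operatorname{NC}(n)$ is the set of non-crossing partitions of $\{1,\dots,n\}$. The Kreweras complement $K(\pi)$ of $\pi\in\operatorname{NC}(n)$ is the maximal (for the order in which $\sigma\le\pi$ iff every block of $\sigma$ lies in a block of $\pi$) non-crossing partition of $\{\bar1,\dots,\bar n\}$ (identified with $\{1,\dots,n\}$) such that $\pi\cup K(\pi)$ is a non-crossing partition of $1<\bar1<2<\bar2<\dots<n<\bar n$. For $w=(i_1\dots i_n)$ and $V=\{v_1<\dots<v_m\}$, $w|V=(i_{v_1}\dots i_{v_m})$, and $X_{w,\pi}(f)=\prod_{V\in\pi}X_{w|V}(f)$. The boxed convolution is given by $X_w(f\boxtimes g)=\sum_{\pi\in\operatorname{NC}(|w|)}X_{w,\pi}(f)\,X_{w,K(\pi)}(g)$.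 $\mathfrak{G}^s_+(R)$ is the set of $f\in R_+\langle\langle z_1,\dots,z_s\rangle\rangle$ with $X_i(f)=1$ for $i=1,\dots,s$; it is a group under $\boxtimes$ with neutral element $z_1+\dots+z_s$. The functor $\mathfrak{G}^s_+$ acts on algebra morphisms coefficientwise, and $\mathbb{G}_a^{\mathbb{N}}(R)=(R^{\mathbb{N}},+)$. *)

(* Defs.v *)
From HB Require Import structures.
From mathcomp Require Import all_boot all_order all_algebra.
From mathcomp Require Import boolp.

Set Implicit Arguments.
Unset Strict Implicit.
Unset Printing Implicit Defensive.

Import GRing.Theory.

Local Open Scope ring_scope.

(* The set {1, ..., n} is 'I_n; blocks of a [partition] are nonempty.         *)
Section NonCrossing.
Variable n : nat.
Implicit Types (U V : {set 'I_n}) (p q : {set {set 'I_n}}).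

Definition crossing U V : bool :=
  [exists a in U, exists b in V, exists c in U, exists d in V,
     [&& (a < b)%N, (b < c)%N & (c < d)%N]].

Definition noncrossing p : bool :=
  [forall U in p, forall V in p, (U != V) ==> ~~ crossing U V].

Definition NC : {set {set {set 'I_n}}} :=
  [set p | partition p [set: 'I_n] && noncrossing p].

Definition finer q p : bool := [forall U in q, exists V in p, U \subset V].

Fact interleave_subproof (b : bool) (i : 'I_n) : (b + i.*2 < n.*2)%N.
Proof.
by apply: (@leq_trans i.+1.*2); [rewrite doubleS; case: b | rewrite leq_double].
Qed.

(* The chain 1 < 1bar < 2 < 2bar < ... < n < nbar is 'I_n.*2: the element of  *)
(* index i sits at position 2i if it is unbarred, at 2i+1 if it is barred.    *)
Definition interleave_ord (b : bool) (i : 'I_n) : 'I_n.*2 :=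
  Ordinal (interleave_subproof b i).

Definition interleave p q : {set {set 'I_n.*2}} :=
  [set interleave_ord false @: (U : {set 'I_n}) | U in p]
    :|: [set interleave_ord true @: (V : {set 'I_n}) | V in q].

End NonCrossing.

Definition kreweras_candidates n (p : {set {set 'I_n}}) :
    {set {set {set 'I_n}}} :=
  [set q in NC n | interleave p q \in NC n.*2].

(* The greatest candidate for refinement; the default value set0 is never     *)
(* reached when p is a non-crossing partition.                                *)
Definition kreweras n (p : {set {set 'I_n}}) : {set {set 'I_n}} :=
  odflt set0 [pick q in kreweras_candidates p
             | [forall r in kreweras_candidates p, finer r q]].

Section Series.
Variables (s : nat) (R : comPzRingType).

(* A series is given by its coefficients w |-> X_w(f).                        *)
Definition coefs := seq 'I_s -> R.

(* [enum V] lists V in increasing order.                                      *)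
Definition subword (w : seq 'I_s) (V : {set 'I_(size w)}) : seq 'I_s :=
  [seq tnth (in_tuple w) i | i <- enum V].

Definition coef_part (f : coefs) (w : seq 'I_s)
    (p : {set {set 'I_(size w)}}) : R :=
  \prod_(V in p) f (subword V).

Definition boxconv (f g : coefs) : coefs := fun w =>
  if w is [::] then 0
  else \sum_(p in NC (size w)) coef_part f p * coef_part g (kreweras p).

Record Gplus := MkGplus {
  Gcoef :> seq 'I_s -> R;
  Gcoef_nil : Gcoef [::] = 0;
  Gcoef_letter : forall i, Gcoef [:: i] = 1
}.

Lemma Gplus_eq (f g : Gplus) : Gcoef f =1 Gcoef g -> f = g.
Proof.
case: f g => [f f0 f1] [g g0 g1] /= /funext efg.
by subst g; congr MkGplus; apply: Prop_irrelevance.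
Qed.

End Series.

Lemma partition_ord1 (p : {set {set 'I_1}}) :
  partition p [set: 'I_1] -> p = [set [set: 'I_1]].
Proof.
move=> pP; case/and3P: (pP) => /eqP cov _ p0.
have full U : U \in p -> U = [set: 'I_1].
  move=> Up; have /set0Pn[x xU] : U != set0.
    by apply: contraNneq p0 => <-.
  by apply/setP => y; rewrite !inE (ord1 y) -(ord1 x).
have /bigcupP[U Up _] : ord0 \in cover p by rewrite cov inE.
apply/setP => V; rewrite inE; apply/idP/eqP => [/full //|->].
by rewrite -(full _ Up).
Qed.

Lemma noncrossing_small n (p : {set {set 'I_n}}) : (n <= 3)%N -> noncrossing p.
Proof.
move=> n3; apply/'forall_implyP => U _; apply/'forall_implyP => V _.
apply/implyP => _; apply/negP.
case/'exists_andP => a [_ /'exists_andP[b [_ /'exists_andP[c [_]]]]].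
case/'exists_andP => d [_ /and3P[ab bc cd]].
have := leq_trans (ltn_ord d) n3; rewrite ltnS => d3.
have b1 := leq_ltn_trans (leq0n a) ab; have c2 := leq_ltn_trans b1 bc.
by have := leq_trans (leq_ltn_trans c2 cd) d3.
Qed.

Lemma NC1 : NC 1 = [set [set [set: 'I_1]]].
Proof.
apply/setP => p; rewrite !inE noncrossing_small // andbT.
apply/idP/eqP => [/partition_ord1 //|->].
rewrite /partition /cover big_set1 eqxx trivIset1 /= inE eq_sym.
by apply/set0Pn; exists ord0; rewrite inE.
Qed.

Lemma kreweras1 : kreweras [set [set: 'I_1]] = [set [set: 'I_1]].
Proof.
have T1 b : interleave_ord b @: [set: 'I_1] = [set interleave_ord b ord0].
  by rewrite (_ : [set: _] = [set ord0]) ?imset_set1 //;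
    apply/setP => x; rewrite !inE (ord1 x).
have cand : [set [set: 'I_1]] \in kreweras_candidates [set [set: 'I_1]].
  rewrite !inE !noncrossing_small // !andbT; apply/andP; split.
    by have := set11 [set [set: 'I_1]]; rewrite -NC1 inE => /andP[].
  rewrite /interleave !imset_set1 !T1; apply/and3P; split.
  - rewrite /cover bigcup_setU !big_set1; apply/eqP/setP => x; rewrite !inE.
    by case: x => [[|[|//]]] ?; rewrite -!val_eqE.
  - apply/trivIsetP => U V; rewrite !inE.
    by move=> /orP[]/eqP-> /orP[]/eqP->; rewrite ?eqxx // disjoints1 inE
      -!val_eqE.
  - by rewrite !inE !(eq_sym set0) negb_or; apply/andP; split;
      apply/set0Pn; eexists; apply: set11.
rewrite /kreweras; case: pickP => [q|/(_ [set [set: 'I_1]])].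
  by rewrite inE NC1 !inE => /andP[/andP[/eqP->]].
rewrite cand /= => /negP[]; apply/'forall_implyP => r.
rewrite inE NC1 inE => /andP[/eqP-> _].
by apply/'forall_implyP => U UT; apply/exists_inP; exists U.
Qed.

Section Boxtimes.
Variables (s : nat) (R : comPzRingType).
Implicit Types f g : Gplus s R.

Lemma boxconv_letter f g i : boxconv f g [:: i] = 1.
Proof.
rewrite /boxconv /= NC1 big_set1 kreweras1 /coef_part !big_set1.
have -> : subword [set: 'I_(size [:: i])] = [:: i].
  by rewrite /subword enum_setT -enumT /= enum_ordSl enum_ord0.
by rewrite !Gcoef_letter mulr1.
Qed.

Definition boxtimes f g : Gplus s R :=
  @MkGplus s R (boxconv f g) erefl (boxconv_letter f g).

End Boxtimes.

(* [comAlgType k] excludes the zero ring, hence the description of commutative*)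
(* unital k-algebras through their structure morphism.                        *)
Record comAlgebra (k : comPzRingType) := ComAlgebra {
  alg_sort :> comPzRingType;
  alg_struct : {rmorphism k -> alg_sort}
}.

Record algMorphism (k : comPzRingType) (A B : comAlgebra k) := AlgMorphism {
  algmor :> {rmorphism A -> B};
  algmor_struct : forall c : k, algmor (alg_struct A c) = alg_struct B c
}.

Section Functoriality.
Variables (s : nat) (A B : comPzRingType) (phi : {rmorphism A -> B}).

Lemma Gmap_nil (f : Gplus s A) : phi (f [::]) = 0.
Proof. by rewrite Gcoef_nil rmorph0. Qed.

Lemma Gmap_letter (f : Gplus s A) i : phi (f [:: i]) = 1.
Proof. by rewrite Gcoef_letter rmorph1. Qed.

Definition Gmap (f : Gplus s A) : Gplus s B :=
  @MkGplus s B (fun w => phi (f w)) (Gmap_nil f) (Gmap_letter f).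

End Functoriality.

Definition add_seq (R : comPzRingType) (a b : nat -> R) : nat -> R :=
  fun i => a i + b i.

Definition group_isomorphism (G H : Type) (mulG : G -> G -> G)
    (mulH : H -> H -> H) (phi : G -> H) : Prop :=
  bijective phi /\ {morph phi : x y / mulG x y >-> mulH x y}.

Definition functor_isomorphism (s : nat) (k : comPzRingType)
    (eta : forall A : comAlgebra k, (nat -> A) -> Gplus s A) : Prop :=
  (forall A : comAlgebra k,
     group_isomorphism (@add_seq A) (@boxtimes s A) (eta A)) /\
  (forall (A B : comAlgebra k) (phi : algMorphism A B) (a : nat -> A),
     eta B (fun i => phi (a i)) = Gmap phi (eta A a)).

(* Main.v *)
(* Part (i). Interleaving [p] and its Kreweras complement gives a two-coloured *)
(* non-crossing partition of a chain of 2n points. For h = f \boxtimes g, let  *)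
(* A and B be the generating series of the same sums over chains of odd       *)
(* length, indexed by the colour of their endpoints. Splitting chains at the  *)
(* last point of the block of the first point yields A B = z h and            *)
(* h = f(A) = g(B). If f = z sigma(f) and g = z tau(g), then h = A sigma(h) = *)
(* B tau(h), so h^2 = z h (sigma tau)(h), that is h = z (sigma tau)(h). Hence *)
(* f |-> sigma carries \boxtimes to the product of series with constant term  *)
(* 1, which logarithmic derivatives identify with (R^N, +) when the positive  *)
(* integers are invertible in R.                                              *)
(*                                                                            *)
(* Part (ii). With f_xy = 1 and g_yx = 1 as the only nonzero coefficients of  *)
(* length at least 2, X_xyx is 1 at f \boxtimes g and 0 at g \boxtimes f.     *)

From HB Require Import structures.
Require Import Defs.
From mathcomp Require Import all_boot all_order all_algebra.
From mathcomp Require Import boolp zify ring.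

Set Implicit Arguments.
Unset Strict Implicit.
Unset Printing Implicit Defensive.

Import GRing.Theory.

Local Open Scope ring_scope.

(** * Truncated power series *)

(** For part (i), the point is to turn a sum over a non-crossing partition and its complement into a
    recursion. Such a pair is a chain of 2n alternately coloured points in which two points of one
    colour are joined exactly when no block of the other colour separates them ([kreweras_arcs],
    [chain_exists], [NC_sum_chains]). This description is symmetric in the colours and can be cut: a
    chain of even length splits uniquely into two of odd length, and a chain of odd length may drop
    its first point, which lies in the block of the last one ([chain_sum_even], [chain_sum_odd]).

    The resulting equations between generating series ([odd_series_product]) show that the series
    sigma in f = z sigma(f) multiply ([lagrange_product]), and logarithmic derivatives turn products
    into sums ([log_derivativeD]). The passages between f, sigma and sigma'/sigma are bijective,
    because in each equation a coefficient is determined by the earlier ones, given inverses of the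
    positive integers.

    For part (ii), evaluation at k itself suffices: an isomorphism with an additive group would make
    the products commute, whereas the coefficient of xyx tells them apart ([boxtimes_not_comm]). *)

Section Causal.
Variables (T : Type) (F : (nat -> T) -> nat -> T).
Hypothesis causalF :
  forall u v n, (forall i, (i < n)%N -> u i = v i) -> F u n = F v n.

(** The first m terms of the m-th iterate of [F] no longer change under further iteration, so term n
    can be read off iterate n+1. *)
Lemma causal_fixpoint (t0 : T) : exists u, forall n, u n = F u n.
Proof.
pose U m := iter m F (fun _ => t0).
have stable n m m' : (n < m)%N -> (n < m')%N -> U m n = U m' n.
  elim/ltn_ind: n m m' => n IH [|m] [|m'] // nm nm'.
  rewrite /U !iterS; apply: causalF => i lt_in.
  by apply: IH; lia.
exists (fun n => U n.+1 n) => n; rewrite {1}/U iterS.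
by apply: causalF => i lt_in; apply: stable; lia.
Qed.

Lemma causal_fixpoint_unique u v :
  (forall n, u n = F u n) -> (forall n, v n = F v n) -> u =1 v.
Proof.
move=> hu hv n; elim/ltn_ind: n => n IH.
by rewrite hu hv; apply: causalF.
Qed.

End Causal.

Section TruncatedSeries.
Variable R : comNzRingType.
Implicit Types (p q h : {poly R}) (u v : nat -> R).

Definition eq_upto N p q := forall i, (i < N)%N -> p`_i = q`_i.

Lemma eq_upto_trans N p q h : eq_upto N p q -> eq_upto N q h -> eq_upto N p h.
Proof. by move=> pq qh i iN; rewrite pq ?qh. Qed.

Lemma eq_upto_sym N p q : eq_upto N p q -> eq_upto N q p.
Proof. by move=> pq i iN; rewrite pq. Qed.

Lemma eq_upto_le M N p q : (M <= N)%N -> eq_upto N p q -> eq_upto M p q.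
Proof. by move=> MN pq i iM; apply: pq; lia. Qed.

Lemma eq_uptoD N p q p' q' :
  eq_upto N p p' -> eq_upto N q q' -> eq_upto N (p + q) (p' + q').
Proof. by move=> pp qq i iN; rewrite !coefD pp ?qq. Qed.

Lemma eq_uptoM N p q p' q' :
  eq_upto N p p' -> eq_upto N q q' -> eq_upto N (p * q) (p' * q').
Proof.
move=> pp qq i iN; rewrite !coefM; apply: eq_bigr => j _.
by rewrite pp ?qq //; have := ltn_ord j; lia.
Qed.

Lemma eq_uptoXn N p q k :
  eq_upto N p q -> eq_upto N (p ^+ k) (q ^+ k).
Proof.
by move=> pq; elim: k => [//|k IH]; rewrite !exprS; apply: eq_uptoM.
Qed.

Lemma eq_upto_mulX N p q : eq_upto N.+1 ('X * p) ('X * q) <-> eq_upto N p q.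
Proof.
split=> pq i iN; first by have := pq i.+1 iN; rewrite !coefXM.
by rewrite !coefXM; case: i iN => //= i iN; apply: pq.
Qed.

Lemma coef_exp_lt h n k : h`_0 = 0 -> (n < k)%N -> (h ^+ k)`_n = 0.
Proof.
move=> h0; elim: k n => [//|k IH] n nk.
rewrite exprS coefM big1 // => -[[|j] ltj] _ /=; first by rewrite h0 mul0r.
by rewrite IH ?mulr0 //; lia.
Qed.

Lemma coef_exp_diag h n : h`_0 = 0 -> (h ^+ n)`_n = h`_1 ^+ n.
Proof.
move=> h0; elim: n => [|n IH]; first by rewrite !expr0 coef1.
rewrite exprS coefM (bigD1 (@Ordinal n.+2 1 isT)) //= subSS subn0 IH -exprS.
rewrite big1 ?addr0 // => -[[|[|j]] ltj] //= _; first by rewrite h0 mul0r.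
by rewrite coef_exp_lt ?mulr0 //; lia.
Qed.

(** As h has no constant term, its i-th power starts in degree i at the earliest, so only the terms
    with i <= n reach degree n. This makes composition compatible with truncation. *)
Lemma coef_comp_upto p h n : h`_0 = 0 ->
  (p \Po h)`_n = \sum_(i < n.+1) p`_i * (h ^+ i)`_n.
Proof.
move=> h0; rewrite comp_polyE coef_sum.
under eq_bigr do rewrite coefZ.
rewrite -(big_mkord xpredT (fun i => p`_i * (h ^+ i)`_n)).
rewrite -(big_mkord xpredT (fun i => p`_i * (h ^+ i)`_n)).
pose m := maxn (size p) n.+1.
rewrite (big_nat_widen 0 (size p) m) ?leq_maxl //.
rewrite (big_nat_widen 0 n.+1 m) ?leq_maxr //= big_mkcond [RHS]big_mkcond.
apply: eq_bigr => i _ /=.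
case: ltnP => [_|pi]; case: ltnP => // ni; first by rewrite coef_exp_lt ?mulr0.
by rewrite nth_default ?mul0r.
Qed.

Lemma eq_upto_comp N p p' h h' : h`_0 = 0 -> h'`_0 = 0 ->
  eq_upto N p p' -> eq_upto N h h' -> eq_upto N (p \Po h) (p' \Po h').
Proof.
move=> h0 h'0 pp hh i iN; rewrite !coef_comp_upto //; apply: eq_bigr => j _.
rewrite pp; last by have := ltn_ord j; lia.
by rewrite (eq_uptoXn j hh).
Qed.

Lemma eq_upto_cancel N p q h : h`_0 = 1 ->
  eq_upto N (h * p) (h * q) -> eq_upto N p q.
Proof.
move=> h0 e i; elim/ltn_ind: i => i IH iN.
have := e i iN; rewrite !coefM !big_ord_recl /= h0 !mul1r !subn0.
rewrite [X in _ + X = _](_ :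
  _ = \sum_(j < i) h`_(bump 0 j) * q`_(i - bump 0 j)).
  by move/addIr.
apply: eq_bigr => -[j ltj] _ /=; rewrite IH //; rewrite /bump /=; lia.
Qed.

(** A power series is its sequence of coefficients; products, compositions and derivatives are
    computed on polynomial truncations, modulo z^N through [eq_upto N]. *)
Definition trunc N u : {poly R} := \poly_(i < N) u i.

Lemma trunc_coef N u i : (i < N)%N -> (trunc N u)`_i = u i.
Proof. by move=> iN; rewrite coef_poly iN. Qed.

Lemma trunc_eq N u v : (forall i, (i < N)%N -> u i = v i) ->
  trunc N u = trunc N v.
Proof.
by move=> uv; apply/polyP => i; rewrite !coef_poly; case: ifP => // /uv.
Qed.

Lemma trunc_upto M N u : (M <= N)%N -> eq_upto M (trunc M u) (trunc N u).
Proof. by move=> MN i iM; rewrite !trunc_coef //; lia. Qed.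

Lemma trunc0 N u : u 0%N = 0 -> (trunc N u)`_0 = 0.
Proof. by move=> u0; rewrite coef_poly u0 if_same. Qed.

Definition cauchy u v n := \sum_(i < n.+1) u i * v (n - i)%N.

Lemma trunc_cauchy N u v :
  eq_upto N (trunc N (cauchy u v)) (trunc N u * trunc N v).
Proof.
move=> i iN; rewrite trunc_coef // coefM; apply: eq_bigr => j _.
by rewrite !trunc_coef //; have := ltn_ord j; lia.
Qed.

(* Lagrange's implicit equation [f = z sigma(f)]; in terms of the S-transform *)
(* of [f], [sigma] is its multiplicative inverse.                             *)
Definition lagrange_solution (sigma f : nat -> R) :=
  f 0%N = 0 /\
  forall n, f n.+1 = (trunc n.+1 sigma \Po trunc n.+1 f)`_n.

(** The factor z shifts degrees by one, so coefficient n+1 of the right-hand side only sees the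
    coefficients of sigma and f up to n; any longer truncation gives the same value. *)
Lemma lagrange_solutionP sigma f : lagrange_solution sigma f <->
  f 0%N = 0 /\
  forall N, eq_upto N (trunc N f) ('X * (trunc N sigma \Po trunc N f)).
Proof.
split=> -[f0 ef]; split=> // N; last first.
  have := ef N.+2 N.+1 (ltnSn _).
  rewrite trunc_coef // coefXM /= => ->.
  apply: (@eq_upto_comp N.+1); rewrite ?trunc0 //;
    by apply/eq_upto_sym/trunc_upto.
move=> [|i] iN; first by rewrite trunc_coef // coefXM.
rewrite trunc_coef // coefXM /= ef.
by apply: (@eq_upto_comp i.+1); rewrite ?trunc0 //; apply/trunc_upto; lia.
Qed.

Lemma lagrange_one sigma f : sigma 0%N = 1 -> lagrange_solution sigma f ->
  f 1%N = 1.
Proof.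
move=> s0 [f0 ->]; rewrite coef_comp_upto ?trunc0 // big_ord1 trunc_coef //.
by rewrite s0 mul1r expr0 coef1.
Qed.

(** Solved for f, the equation is a causal recursion. The product ['X * drop_poly 1] resets the
    constant term to 0 and leaves the truncation as it is once [u 0 = 0]. *)
Let lagrange_step (sigma u : nat -> R) n : R :=
  if n is m.+1 then (trunc n sigma \Po ('X * drop_poly 1
    (trunc n u)))`_m else 0.

Let trunc_shift N u : u 0%N = 0 -> 'X * drop_poly 1 (trunc N u) = trunc N u.
Proof.
move=> u0; apply/polyP => -[|i]; rewrite coefXM /= ?trunc0 //.
by rewrite coef_drop_poly addn1.
Qed.

Let lagrange_stepP (sigma f : nat -> R) :
  lagrange_solution sigma f <-> forall n, f n = lagrange_step sigma f n.
Proof.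
split=> [[f0 ef] [|n] //= | ef]; first by rewrite trunc_shift.
have f0 : f 0%N = 0 by rewrite ef.
by split=> // n; rewrite ef /= trunc_shift.
Qed.

Let lagrange_step_causal (sigma u v : nat -> R) n :
  (forall i, (i < n)%N -> u i = v i) ->
  lagrange_step sigma u n = lagrange_step sigma v n.
Proof. by case: n => //= n uv; rewrite (trunc_eq uv). Qed.

Lemma lagrange_exists sigma : exists f, lagrange_solution sigma f.
Proof.
have [f ef] := causal_fixpoint (@lagrange_step_causal sigma) 0.
by exists f; apply/lagrange_stepP.
Qed.

Lemma lagrange_unique sigma f g :
  lagrange_solution sigma f -> lagrange_solution sigma g -> f =1 g.
Proof.
move=> /lagrange_stepP ef /lagrange_stepP eg.
exact: (causal_fixpoint_unique (@lagrange_step_causal sigma) ef eg).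
Qed.

(** Solved for sigma: in degree n of sigma(f), the coefficient sigma_n is multiplied by f_1^n = 1,
    and the other terms involve smaller indices of sigma. *)
Let colagrange_step (f u : nat -> R) n :=
  f n.+1 - (trunc n u \Po trunc n.+1 f)`_n.

Let colagrange_stepP (sigma f : nat -> R) : f 0%N = 0 -> f 1%N = 1 ->
  lagrange_solution sigma f <-> forall n, sigma n = colagrange_step f sigma n.
Proof.
move=> f0 f1.
have top n : (trunc n.+1 sigma \Po trunc n.+1 f)`_n =
    sigma n + (trunc n sigma \Po trunc n.+1 f)`_n.
  rewrite !coef_comp_upto ?trunc0 // !big_ord_recr /=.
  rewrite coef_exp_diag ?trunc0 // (trunc_coef sigma (ltnSn n)).
  rewrite (_ : (trunc n sigma)`_n = 0); last by rewrite coef_poly ltnn.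
  rewrite mul0r addr0 addrC; congr (_ + _).
    by case: n => [|n]; rewrite ?expr0 ?mulr1 // trunc_coef // f1 expr1n mulr1.
  apply: eq_bigr => i _; congr (_ * _).
  by rewrite !trunc_coef //; have := ltn_ord i; lia.
split=> [[_ ef] n|es]; first by rewrite /colagrange_step ef top addrK.
by split=> // n; rewrite top {1}es /colagrange_step subrK.
Qed.

Let colagrange_step_causal (f u v : nat -> R) n :
  (forall i, (i < n)%N -> u i = v i) ->
  colagrange_step f u n = colagrange_step f v n.
Proof. by move=> uv; rewrite /colagrange_step (trunc_eq uv). Qed.

Lemma lagrange_symbol_exists f : f 0%N = 0 -> f 1%N = 1 ->
  exists2 sigma, sigma 0%N = 1 & lagrange_solution sigma f.
Proof.
move=> f0 f1.
have [s es] := causal_fixpoint (@colagrange_step_causal f) 0.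
exists s; last by apply/colagrange_stepP.
rewrite es /colagrange_step coef_comp_upto ?trunc0 // big_ord1.
by rewrite (_ : (trunc 0 s)`_0 = 0) ?coef_poly // mul0r subr0.
Qed.

Lemma lagrange_symbol_unique f sigma tau : f 0%N = 0 -> f 1%N = 1 ->
  lagrange_solution sigma f -> lagrange_solution tau f -> sigma =1 tau.
Proof.
move=> f0 f1 /(colagrange_stepP _ f0 f1) es /(colagrange_stepP _ f0 f1) et.
exact: (causal_fixpoint_unique (@colagrange_step_causal f) es et).
Qed.

(* Substituting [A] in [f = z sigma(f)] and [B] in [g = z tau(g)] turns       *)
(* [A * B = z h] with [h = f(A) = g(B)] into [h ^ 2 = z h (sigma tau)(h)].    *)
Lemma lagrange_product (sigma tau f g h : nat -> R) :
    lagrange_solution sigma f -> lagrange_solution tau g -> h 0%N = 0 ->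
      h 1%N = 1 ->
    (forall N, exists A B : {poly R},
      [/\ A`_0 = 0, B`_0 = 0, eq_upto N ('X * trunc N h) (A * B),
          eq_upto N (A * B) ('X * (trunc N f \Po A))
        & eq_upto N (A * B) ('X * (trunc N g \Po B))]) ->
  lagrange_solution (cauchy sigma tau) h.
Proof.
move=> /lagrange_solutionP[f0 ef] /lagrange_solutionP[g0 eg] h0 h1 AB.
apply/lagrange_solutionP; split=> // N.
(* Two degrees are spent on cancelling z: once to obtain H = f(A) = g(B), once to obtain the final
   equation. *)
have [A [B [A0 B0 hAB ABf ABg]]] := AB N.+2.
pose H := trunc N.+2 h.
have H0 : H`_0 = 0 by rewrite /H trunc0.
have XA (C : {poly R}) : ('X * C)`_0 = 0 by rewrite coefXM.
(* Composing w = z s(w) with C and using H = w(C) gives H = C s(H). *)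
have key (s w : nat -> R) (C : {poly R}) : C`_0 = 0 -> w 0%N = 0 ->
    eq_upto N.+2 (trunc N.+2 w) ('X * (trunc N.+2 s \Po trunc N.+2 w)) ->
    eq_upto N.+2 (A * B) ('X * (trunc N.+2 w \Po C)) ->
    eq_upto N.+1 H (C * (trunc N.+2 s \Po H)).
  move=> C0 w0 ew ABw.
  have HC : eq_upto N.+1 H (trunc N.+2 w \Po C).
    by apply/eq_upto_mulX; apply: eq_upto_trans hAB ABw.
  apply: (eq_upto_trans HC).
  have : eq_upto N.+2 (trunc N.+2 w \Po C)
            (('X * (trunc N.+2 s \Po trunc N.+2 w)) \Po C).
    exact: eq_upto_comp.
  move=> /(eq_upto_le (leqnSn _))/eq_upto_trans; apply.
  rewrite comp_polyM comp_polyX -comp_polyA; apply: eq_uptoM => //.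
  apply: eq_upto_comp => //; last exact: eq_upto_sym.
  by rewrite HC // in H0.
have HA := key _ _ _ A0 f0 (ef _) ABf; have HB := key _ _ _ B0 g0 (eg _) ABg.
have HH : eq_upto N.+1 (H * H) (H * ('X * (trunc N.+2
  (cauchy sigma tau) \Po H))).
  apply: (eq_upto_trans (eq_uptoM HA HB)).
  have -> : A * (trunc N.+2 sigma \Po H) * (B * (trunc N.+2 tau \Po H)) =
     (A * B) * ((trunc N.+2 sigma * trunc N.+2 tau) \Po H).
    by rewrite comp_polyM; ring.
  rewrite mulrA (mulrC H); apply: eq_uptoM.
    by apply: (eq_upto_le (leqnSn _)); apply: eq_upto_sym.
  apply: eq_upto_comp => //; apply: eq_upto_sym.
  exact/(eq_upto_le (leqnSn _))/trunc_cauchy.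
(* The equation for H^2 is divided by H, which is z times a series with constant term 1. *)
have HX : H = 'X * drop_poly 1 H by rewrite trunc_shift.
have D1 : (drop_poly 1 H)`_0 = 1 by rewrite coef_drop_poly addn1 trunc_coef.
rewrite {1 3}HX -!mulrA in HH.
move/eq_upto_mulX/(eq_upto_cancel D1): HH => HH.
have NH := trunc_upto h (leqW (leqnSn N)).
apply: (eq_upto_trans NH); apply: (eq_upto_trans HH).
apply: eq_uptoM => //; apply: eq_upto_comp; rewrite ?trunc0 //.
  exact/eq_upto_sym/trunc_upto/leqW/leqnSn.
exact: eq_upto_sym.
Qed.

(* [sigma' = alpha sigma].                                                    *)
Definition log_derivative (alpha sigma : nat -> R) :=
  sigma 0%N = 1 /\ forall n, sigma n.+1 *+ n.+1 = cauchy alpha sigma n.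

(** Leibniz's rule: (sigma tau)' = alpha sigma tau + sigma beta tau = (alpha + beta) sigma tau. *)
Lemma log_derivativeD alpha beta sigma tau :
  log_derivative alpha sigma -> log_derivative beta tau ->
  log_derivative (fun i => alpha i + beta i) (cauchy sigma tau).
Proof.
move=> [s0 es] [t0 et]; split=> [|n].
  by rewrite /cauchy big_ord1 s0 t0 mulr1.
have deriv_upto (a s : nat -> R) : (forall m, s m.+1 *+ m.+1 = cauchy a s m) ->
    eq_upto n.+1 (trunc n.+2 s)^`() (trunc n.+2 a * trunc n.+2 s).
  move=> e i iN; rewrite coef_deriv trunc_coef // e.
  by rewrite -trunc_cauchy ?trunc_coef //; lia.
have st := @trunc_cauchy n.+2 sigma tau.
transitivity (trunc n.+2 sigma * trunc n.+2 tau)^`()`_n.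
  by rewrite coef_deriv -st // trunc_coef.
rewrite derivM coefD (eq_uptoM (deriv_upto _ _ es) (q := trunc n.+2 tau)
  (q' := trunc n.+2 tau)) //.
rewrite (eq_uptoM (p := trunc n.+2 sigma) (p' := trunc n.+2 sigma) _
  (deriv_upto _ _ et)) // -coefD.
set s := trunc _ sigma; set t := trunc _ tau.
have -> : trunc n.+2 alpha * s * t + s * (trunc n.+2 beta * t) =
  trunc n.+2 (fun i => alpha i + beta i) * (s * t).
  have -> : trunc n.+2 (fun i => alpha i + beta i) =
      trunc n.+2 alpha + trunc n.+2 beta.
    by apply/polyP => i; rewrite coefD !coef_poly; case: ifP; rewrite ?addr0.
  by ring.
rewrite (eq_uptoM (p := trunc n.+2 (fun i => alpha i + beta i))
  (fun i _ => erefl)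
  (eq_upto_sym st)) //.
by rewrite -trunc_cauchy // trunc_coef.
Qed.

(** Coefficient n+1 of sigma is coefficient n of alpha sigma divided by n+1, and the latter only
    involves sigma up to n. *)
Lemma log_derivative_exists alpha : (forall n, exists c : R, c *+ n.+1 = 1) ->
  exists sigma, log_derivative alpha sigma.
Proof.
move=> /choice[c ec].
pose F (u : nat -> R) n :=
  if n is m.+1 then c m * (\sum_(i < n) alpha i * u (m - i)%N) else 1.
have [|s es] := @causal_fixpoint _ F _ 0.
  move=> u v [//|n] uv /=; congr (_ * _); apply: eq_bigr => i _.
  by rewrite uv //; lia.
by exists s; split=> [|n]; rewrite es //= -mulrnAl ec mul1r.
Qed.

Lemma log_derivative_unique alpha sigma tau :
    (forall n, exists c : R, c *+ n.+1 = 1) ->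
  log_derivative alpha sigma -> log_derivative alpha tau -> sigma =1 tau.
Proof.
move=> hc [s0 es] [t0 et] n; elim/ltn_ind: n => -[|n] IH; first by rewrite s0.
have [c ec] := hc n.
rewrite -[LHS]mul1r -[RHS]mul1r -ec !mulrnAl -!mulrnAr es et; congr (_ * _).
by apply: eq_bigr => i _; rewrite IH //; lia.
Qed.

(** Solved for alpha, the equation is again causal, since alpha_n is multiplied by the constant term
    1 of sigma. *)
Let colog_step (s u : nat -> R) n :=
  s n.+1 *+ n.+1 - \sum_(i < n) u i * s (n - i)%N.

Let colog_stepP (alpha sigma : nat -> R) : sigma 0%N = 1 ->
  log_derivative alpha sigma <-> forall n, alpha n = colog_step sigma alpha n.
Proof.
move=> s0.
have top n : cauchy alpha sigma n = alpha n + \sum_(i < n) alpha i * sigma (n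
  - i)%N.
  by rewrite /cauchy big_ord_recr /= subnn s0 mulr1 addrC.
split=> [[_ es] n|ea]; first by rewrite /colog_step es top addrK.
by split=> // n; rewrite top {1}ea /colog_step subrK.
Qed.

Let colog_step_causal (s u v : nat -> R) n :
  (forall i, (i < n)%N -> u i = v i) -> colog_step s u n = colog_step s v n.
Proof.
by move=> uv; rewrite /colog_step; congr (_ - _); apply: eq_bigr => i _;
  rewrite uv.
Qed.

Lemma log_exists sigma : sigma 0%N = 1 ->
  exists alpha, log_derivative alpha sigma.
Proof.
move=> s0; have [a ea] := causal_fixpoint (@colog_step_causal sigma) 0.
by exists a; apply/colog_stepP.
Qed.

Lemma log_unique sigma alpha beta :
  log_derivative alpha sigma -> log_derivative beta sigma -> alpha =1 beta.
Proof.
move=> ha hb; have s0 := ha.1.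
move: ha hb => /(colog_stepP _ s0) ea /(colog_stepP _ s0) eb.
exact: (causal_fixpoint_unique (@colog_step_causal sigma) ea eb).
Qed.

End TruncatedSeries.

(** * Two-coloured non-crossing partitions of a chain *)

(* Discarding parity facts keeps the case analysis of [lia] small.            *)
Local Ltac lia_noodd :=
  repeat match goal with H : context [odd _] |- _ => clear H end; lia.

Section Chains.
Variable N : nat.
Implicit Types (r : {ffun 'I_N -> 'I_N}) (x y z w : 'I_N) (a b c : nat).

(** A block of the other colour has a point z between x and y and a point w outside, so a block
    containing both x and y would cross it. *)
Definition separated a b r x y :=
  [exists z : 'I_N, exists w : 'I_N, [&& (x < z < y)%N, (a <= w < b)%N,
    (w < x)%N || (y < w)%N, odd z != odd x & r z == r w]].

(* Two-coloured non-crossing partitions of [a, b), the colours being parities,*)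
(* such that the blocks of each colour are the largest ones compatible with   *)
(* the other colour; [r] maps each point to the last point of its block.      *)
Definition chain a b r :=
  [forall x : 'I_N, if (a <= x < b)%N then
     [&& (x <= r x < b)%N, odd (r x) == odd x & r (r x) == r x] else r x == x]
  && [forall x : 'I_N, forall y : 'I_N,
     [&& (a <= x)%N, (x < y)%N, (y < b)%N & odd x == odd y] ==>
     ((r x == r y) == ~~ separated a b r x y)].

Lemma separatedP a b r x y : reflect
  (exists z w, [/\ (x < z < y)%N, (a <= w < b)%N,
     (w < x)%N || (y < w)%N, odd z != odd x & r z = r w])
  (separated a b r x y).
Proof.
apply: (iffP existsP) => [[z /existsP[w /and5P[? ? ? ? /eqP ?]]]|].
  by exists z, w.
by case=> z [w [? ? ? ? /eqP ?]]; exists z; apply/existsP; exists w;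
  apply/and5P.
Qed.

Lemma chainP a b r : reflect
  [/\ forall x, (a <= x < b)%N ->
        [/\ (x <= r x)%N, (r x < b)%N, odd (r x) = odd x & r (r x) = r x],
      forall x, ~~ (a <= x < b)%N -> r x = x
    & forall x y, (a <= x)%N -> (x < y)%N -> (y < b)%N -> odd x = odd y ->
        r x = r y <-> ~ separated a b r x y]
  (chain a b r).
Proof.
apply: (iffP andP) => [[/forallP rP /'forall_forallP sP]|[inr outr sepr]].
  split=> [x xab|x xab|x y ax xy yb oxy].
  - by have := rP x; rewrite xab => /and3P[/andP[-> ->] /eqP-> /eqP->].
  - by have := rP x; rewrite (negbTE xab) => /eqP.
  - have := sP x y; rewrite ax xy yb oxy eqxx /= => /eqP e.
    by split=> [/eqP|/negP h]; [rewrite e => /negP | apply/eqP; rewrite e].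
split; first apply/forallP => x.
  case: (boolP (a <= x < b)%N) => [/inr[-> -> -> ->]|/outr->].
    by rewrite !eqxx.
  exact: eqxx.
apply/'forall_forallP => x y; apply/implyP => /and4P[ax xy yb /eqP oxy].
have [h1 h2] := sepr x y ax xy yb oxy.
by apply/eqP; apply/idP/idP => [/eqP/h1/negP //|/negP/h2 ->].
Qed.

Section ChainTheory.
Variables (a b : nat) (r : {ffun 'I_N -> 'I_N}).
Hypothesis ch : chain a b r.

Lemma chain_le x : (x <= r x)%N.
Proof.
have [inr outr _] := chainP _ _ _ ch.
by case: (boolP (a <= x < b)%N) => [/inr[]|/outr ->].
Qed.

Lemma chain_lt x : (x < b)%N -> (r x < b)%N.
Proof.
have [inr outr _] := chainP _ _ _ ch => xb.
by case: (boolP (a <= x < b)%N) => [/inr[]|/outr ->].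
Qed.

Lemma chain_odd x : odd (r x) = odd x.
Proof.
have [inr outr _] := chainP _ _ _ ch.
by case: (boolP (a <= x < b)%N) => [/inr[]|/outr ->].
Qed.

Lemma chain_idem x : r (r x) = r x.
Proof.
have [inr outr _] := chainP _ _ _ ch.
by case: (boolP (a <= x < b)%N) => [/inr[]|/outr e]; rewrite ?e.
Qed.

Lemma chain_out x : (x < a)%N || (b <= x)%N -> r x = x.
Proof.
by have [_ outr _] := chainP _ _ _ ch => xab; apply: outr; lia.
Qed.

Lemma chain_sep x y : (a <= x)%N -> (x < y)%N -> (y < b)%N -> odd x = odd y ->
  r x = r y <-> ~ separated a b r x y.
Proof. by have [_ _ h] := chainP _ _ _ ch; apply: h. Qed.

(** For opposite colours, the crossing pair z, w separates x from y. For equal colours, suppose u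
    and v separate x from z. As x and y are not separated, v lies between z and y; then v and u
    separate z from w, which is absurd. *)
Lemma chain_noncrossing x z y w : (a <= x)%N -> (x < z)%N -> (z < y)%N ->
  (y < w)%N -> (w < b)%N -> r x = r y -> r z = r w -> r x = r z.
Proof.
move=> ax xz zy yw wb rxy rzw.
have oxy : odd x = odd y by rewrite -chain_odd rxy chain_odd.
have ozw : odd z = odd w by rewrite -chain_odd rzw chain_odd.
have Nxy : ~ separated a b r x y by apply/chain_sep => //; lia.
have Nzw : ~ separated a b r z w by apply/chain_sep => //; lia.
case: (eqVneq (odd x) (odd z)) => oxz; last first.
  case: Nxy; apply/separatedP; exists z, w.
  by split=> //; try lia_noodd; rewrite eq_sym.
apply/chain_sep => //; first lia_noodd.
case/separatedP=> u [v [xuz avb vxz oux ruv]].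
have vy : (x <= v <= y)%N.
  apply/negP => vxy; case: Nxy; apply/separatedP; exists u, v.
  by split=> //; lia_noodd.
have vNy : v <> y :> nat.
  move=> /val_inj evy; move: oux.
  by rewrite -chain_odd ruv evy chain_odd -oxy eqxx.
have vNx : v <> x :> nat.
  move=> /val_inj evx; move: oux.
  by rewrite -chain_odd ruv evx chain_odd eqxx.
case: Nzw; apply/separatedP; exists v, u; split=> //; try lia_noodd.
by rewrite -chain_odd -ruv chain_odd -oxz.
Qed.

End ChainTheory.

Definition restrict a c r : {ffun 'I_N -> 'I_N} :=
  [ffun x : 'I_N => if (a <= x < c)%N then r x else x].

Definition glue c (p : {ffun 'I_N -> 'I_N} * {ffun 'I_N -> 'I_N}) :
  {ffun 'I_N -> 'I_N} := [ffun x : 'I_N => if (x < c)%N then p.1 x else p.2 x].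

(** The last hypothesis says that the subinterval is a union of blocks; a block separating two of
    its points then lies inside it. *)
Lemma chain_restrict a b a' b' r : chain a b r -> (a <= a')%N -> (b' <= b)%N ->
    (forall x, (a <= x < b)%N -> (a' <= r x < b')%N = (a' <= x < b')%N) ->
  chain a' b' (restrict a' b' r).
Proof.
move=> ch aa bb stab; apply/chainP; split=> [x xab|x xab|x y ax xy yb oxy].
- have rx : (a' <= r x < b')%N by rewrite stab //; lia.
  rewrite !ffunE xab rx (chain_odd ch) (chain_idem ch) (chain_le ch).
  by case/andP: rx.
- by rewrite ffunE (negbTE xab).
have xab : (a' <= x < b')%N by lia.
have yab : (a' <= y < b')%N by lia.
rewrite !ffunE xab yab (chain_sep ch) //; try lia.
suff -> : separated a' b' (restrict a' b' r) x y = separated a b r x y by [].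
apply/separatedP/separatedP => -[z [w [xzy ab ? ? e]]]; exists z, w.
  split=> //; first lia.
  by move: e; rewrite !ffunE !ifT //; lia.
have za : (a' <= z < b')%N by lia.
have wa : (a' <= w < b')%N by rewrite -stab // -e stab //; lia.
by split=> //; rewrite !ffunE za wa.
Qed.

Lemma chain_last a b r y : chain a b r -> y.+1 = b -> r y = y.
Proof.
move=> ch yb; apply/val_inj/eqP; rewrite eqn_leq (chain_le ch) andbT.
by rewrite -ltnS yb (chain_lt ch) //; lia.
Qed.

(** Separating the two endpoints would require a point outside the chain. *)
Lemma chain_odd_last a b r x y : chain a b r -> (a < b)%N -> x = a :> nat ->
  y.+1 = b -> odd x = odd y -> r x = y.
Proof.
move=> ch ab xa yb oxy.
have ry := chain_last ch yb.
have [xy|xy|/val_inj->//] := ltngtP x y; last by lia.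
rewrite -ry; apply/(chain_sep ch) => //; try lia.
by case/separatedP=> z [w [? ? ? _ _]]; lia.
Qed.

(** A block with points on both sides of the cut after [r x] would cross the block of the first
    point x, so both sides are unions of blocks. *)
Lemma chain_even_split a b r x : chain a b r -> x = a :> nat -> (a < b)%N ->
  ~~ odd (b - a) ->
  [/\ (a <= r x)%N, ((r x).+1 < b)%N, ~~ odd (r x - a),
      chain a (r x).+1 (restrict a (r x).+1 r)
    & chain (r x).+1 b (restrict (r x).+1 b r)].
Proof.
move=> ch xa ab oab.
have xr := chain_le ch x; have orx := chain_odd ch x.
have rb : (r x < b)%N by apply: (chain_lt ch); lia.
have stab y : (a <= y < b)%N -> (r y <= r x)%N = (y <= r x)%N.
  move=> yab; apply/idP/idP => [|yr].
    by apply: leq_trans; apply: (chain_le ch).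
  case: (leqP (r y) (r x)) => // rxy.
  have yNr : y <> r x by move=> e; rewrite e (chain_idem ch) ltnn in rxy.
  have yNx : y <> x by move=> e; rewrite e ltnn in rxy.
  suff e : r x = r y by rewrite e ltnn in rxy.
  have yNr' : y <> r x :> nat by move/val_inj.
  have yNx' : y <> x :> nat by move/val_inj.
  apply: (chain_noncrossing ch (y := r x) (w := r y));
    rewrite ?(chain_idem ch) //; try lia.
  by apply: (chain_lt ch); lia.
split; try lia.
  apply: (chain_restrict ch) => //; try lia.
  move=> y yab; rewrite !ltnS stab //.
  have := chain_le ch y; lia.
apply: (chain_restrict ch) => //; try lia.
move=> y yab; rewrite !ltnNge stab //.
have := chain_lt ch (x := y); lia.
Qed.

(** What has to be checked is that any two points of one colour on different sides of c are
    separated in the union, as [glue] never joins them. *)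
Lemma chain_glue a c b p : (a < c)%N -> (c < b)%N -> odd (c - a) ->
    odd (b - c) -> (b <= N)%N -> chain a c p.1 -> chain c b p.2 ->
  chain a b (glue c p).
Proof.
case: p => r1 r2 /= ac cb oac ocb bN ch1 ch2.
have N0 : (0 < N)%N by lia.
have r1c x : (r1 x < c)%N = (x < c)%N.
  apply/idP/idP; last exact: (chain_lt ch1).
  by apply: leq_ltn_trans; apply: (chain_le ch1).
have r2c x : (c <= x)%N -> (c <= r2 x)%N.
  by move=> cx; apply: (leq_trans cx); apply: (chain_le ch2).
have gc x : (glue c (r1, r2) x < c)%N = (x < c)%N.
  rewrite ffunE /=; case: (ltnP x c) => xc; first by rewrite r1c xc.
  by rewrite ltnNge r2c.
have g1 x : (x < c)%N -> glue c (r1, r2) x = r1 x by rewrite ffunE /= => ->.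
have g2 x : (c <= x)%N -> glue c (r1, r2) x = r2 x.
  by rewrite ffunE /= ltnNge => ->.
have inj x y : glue c (r1, r2) x = glue c (r1, r2) y -> (x < c)%N = (y < c)%N.
  by move=> e; rewrite -gc e gc.
apply/chainP; split=> [x xab|x xab|x y ax xy yb oxy].
- case: (ltnP x c) => xc.
    rewrite !g1 ?r1c // (chain_odd ch1) (chain_idem ch1) (chain_le ch1).
    by have := r1c x; rewrite xc; split=> //; lia_noodd.
  rewrite !g2 ?r2c // (chain_odd ch2) (chain_idem ch2) (chain_le ch2).
  by split=> //; apply: (chain_lt ch2); lia_noodd.
- case: (ltnP x c) => xc; first by rewrite g1 // (chain_out ch1) //; lia_noodd.
  by rewrite g2 // (chain_out ch2) //; lia_noodd.
case: (ltnP y c) => yc.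
  rewrite !g1 //; last lia_noodd.
  rewrite (chain_sep ch1) //.
  suff -> : separated a c r1 x y = separated a b (glue c (r1, r2)) x y by [].
  apply/separatedP/separatedP => -[z [w [xzy ab ? ? e]]]; exists z, w.
    by split=> //; [lia_noodd | rewrite !g1 //; lia_noodd].
  have := inj _ _ e; have -> : (z < c)%N by lia_noodd.
  move/esym => wc; split=> //; first lia_noodd.
  by move: e; rewrite !g1 //; lia_noodd.
case: (ltnP x c) => xc; last first.
  rewrite !g2 // (chain_sep ch2) //.
  suff -> : separated c b r2 x y = separated a b (glue c (r1, r2)) x y by [].
  apply/separatedP/separatedP => -[z [w [xzy ab ? ? e]]]; exists z, w.
    by split=> //; [lia_noodd | rewrite !g2 //; lia_noodd].
  have := inj _ _ e; have -> : (z < c)%N = false by lia_noodd.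
  move/esym => wc; split=> //; first lia_noodd.
  by move: e; rewrite !g2 //; lia_noodd.
split=> [/inj|]; first by lia_noodd.
pose o i (iN : (i < N)%N) := Ordinal iN.
have aN : (a < N)%N by lia.
have cN : (c < N)%N by lia.
have c'N : (c.-1 < N)%N by lia.
have bN' : (b.-1 < N)%N by lia.
have oc' : odd c.-1 = odd a by move: (c) ac oac => [//|d]; lia.
have oc : odd c = ~~ odd a by move: oac ac; clear; lia.
have ob' : odd b.-1 = odd c by move: ocb cb; clear; lia.
(* Each odd chain has its endpoints joined: the pair c, b-1 separates points of the colour of a, and
   the pair a, c-1 separates those of the other colour. *)
case; apply/separatedP; case: (eqVneq (odd x) (odd a)) => oxa.
  have yc' : y <> c :> nat.
    by move=> e; move: oxy; rewrite oxa e oc; case: (odd a).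
  have yb' : y <> b.-1 :> nat.
    by move=> e; move: oxy; rewrite oxa e ob' oc; case: (odd a).
  exists (o _ cN), (o _ bN'); split=> /=; try lia_noodd.
    by rewrite oc oxa; case: (odd a).
  rewrite !g2 /=; try lia_noodd.
  by rewrite (chain_odd_last ch2 (x := o _ cN) (y := o _ bN'))
    ?(chain_last ch2) //=; lia_noodd.
have xc' : x <> c.-1 :> nat by move=> e; move: oxa; rewrite e oc' eqxx.
have xa' : x <> a :> nat by move=> e; move: oxa; rewrite e eqxx.
exists (o _ c'N), (o _ aN); split=> /=; try lia_noodd.
  by rewrite oc' eq_sym.
rewrite !g1 /=; try lia_noodd.
by rewrite (chain_odd_last ch1 (x := o _ aN) (y := o _ c'N))
  ?(chain_last ch1) //=; lia_noodd.
Qed.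

End Chains.

(** * Weighted sums over chains and their recursions *)

Section ChainSums.
Variables (R : comNzRingType) (W : bool -> nat -> R) (N : nat).
Implicit Types (r : {ffun 'I_N -> 'I_N}) (x y z : 'I_N) (a b c k : nat).

(* The block ending at [b.-1] is weighted as if it had [k] more elements.     *)
Definition chain_weight k a b r : R :=
  \prod_(y : 'I_N | (a <= y < b)%N && (r y == y))
    W (odd y) (#|[set x | r x == y]| + (if y.+1 == b then k else 0))%N.

Definition chain_sum k a b : R :=
  \sum_(r : {ffun 'I_N -> 'I_N} | chain a b r) chain_weight k a b r.

Lemma restrict_glueK a b c r : chain a b r -> 
  glue c (restrict a c r, restrict c b r) = r.
Proof.
move=> ch; apply/ffunP => x; rewrite !ffunE /=.
have out : (x < a)%N || (b <= x)%N -> r x = x by apply: (chain_out ch).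
case: (ltnP x c) => xc; rewrite ?xc ?andbT /=.
  by case: leqP => // xa; rewrite out ?xa.
by case: ltnP => // xb; rewrite out ?xb ?orbT.
Qed.

Lemma glue_restrictK a b c r1 r2 : chain a c r1 -> chain c b r2 ->
  (a <= c)%N -> (c <= b)%N ->
  restrict a c (glue c (r1, r2)) = r1 /\ restrict c b (glue c (r1, r2)) = r2.
Proof.
move=> ch1 ch2 ac cb; split; apply/ffunP => x; rewrite !ffunE /=.
  case: ifP => [/andP[_ ->] //|xac]; rewrite (chain_out ch1) //; lia.
case: ifP => [/andP[cx _]|xcb]; first by rewrite ltnNge cx.
by rewrite (chain_out ch2) //; lia.
Qed.

(** The block ending at [b.-1] lies in the right-hand chain, which therefore receives the [k] extra
    elements. *)
Lemma chain_weight_glue k a b c r1 r2 : chain a c r1 -> chain c b r2 ->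
    (a <= c)%N -> (c < b)%N ->
  chain_weight k a b (glue c (r1, r2)) =
  chain_weight 0 a c r1 * chain_weight k c b r2.
Proof.
move=> ch1 ch2 ac cb;
  rewrite /chain_weight (bigID (fun y : 'I_N => (y < c)%N)) /=.
congr (_ * _); apply: eq_big => y.
- rewrite ffunE /=; case: (ltnP y c) => yc; rewrite ?andbF //= andbT.
  by congr (_ && _); lia.
- case/andP=> _ yc; congr (W _ (_ + _)%N); last by case: eqP; case: eqP => //;
  lia.
  apply: eq_card => x; rewrite !inE ffunE /=; case: (ltnP x c) => // xc.
  have rx := chain_le ch2 x; rewrite (chain_out ch1) ?xc ?orbT //.
  by apply/eqP/eqP => e; subst y; lia.
- rewrite ffunE /=; case: (ltnP y c) => yc; rewrite ?andbF ?andbT /=.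
    by apply/esym/negbTE; lia.
  by congr (_ && _); lia.
rewrite -leqNgt => /andP[_ yc]; congr (W _ (_ + _)%N).
apply: eq_card => x; rewrite !inE ffunE /=; case: (ltnP x c) => // xc.
have := chain_lt ch1 xc; rewrite (chain_out ch2) ?xc // => rx.
by apply/eqP/eqP => e; subst y; lia.
Qed.

(** The index i is the last point of the block of a; for fixed i, restriction and [glue] are inverse
    bijections between the chains and pairs of odd chains. *)
Lemma chain_sum_even k a b : (a < b)%N -> (b <= N)%N -> ~~ odd (b - a) ->
  chain_sum k a b =
  \sum_(i : 'I_N | [&& (a <= i)%N, (i.+1 < b)%N & ~~ odd (i - a)])
    chain_sum 0 a i.+1 * chain_sum k i.+1 b.
Proof.
move=> ab bN oab; have aN : (a < N)%N by lia.
pose x := Ordinal aN.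
rewrite /chain_sum (partition_big (fun r : {ffun 'I_N -> 'I_N} => r x)
  (fun i : 'I_N => [&& (a <= i)%N, (i.+1 < b)%N & ~~ odd (i - a)])); last first.
  by move=> r ch; have [-> ->
    -> _ _] := chain_even_split ch (erefl : x = a :> nat) ab oab.
apply: eq_bigr => i /and3P[ai ib oi].
rewrite big_distrlr /= pair_big /=.
rewrite (reindex_onto (glue i.+1) 
   (fun r => (restrict a i.+1 r, restrict i.+1 b r))) /=; last first.
  by move=> r /andP[ch _]; apply: restrict_glueK ch.
apply: eq_big => [[r1 r2]|[r1 r2]] /=; last first.
  case/andP=> /andP[ch /eqP ri] /eqP[e1 e2].
  have [_ _ _ ch1 ch2] := chain_even_split ch (erefl : x = a :> nat) ab oab.
  by apply: chain_weight_glue; [move: ch1 | move: ch2 | lia | lia];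
    rewrite ri ?e1 ?e2.
apply/idP/idP => [/andP[/andP[ch /eqP ri] /eqP[e1 e2]]|/andP[ch1 ch2]].
  have [_ _ _] := chain_even_split ch (erefl : x = a :> nat) ab oab.
  by rewrite ri e1 e2 => -> ->.
have [-> ->] := glue_restrictK ch1 ch2 (leqW ai) (ltnW ib).
rewrite eqxx chain_glue //= ?ffunE /=; try lia.
by rewrite ltnS ai (chain_odd_last ch1 (x := x) (y := i)) ?eqxx //=; lia.
Qed.

(** The first point of an odd chain is joined to the last, so dropping it loses nothing but one
    element of the last block, which [k.+1] restores. *)
Lemma chain_sum_odd k a b : (a.+1 < b)%N -> (b <= N)%N -> odd (b - a) ->
  chain_sum k a b = chain_sum k.+1 a.+1 b.
Proof.
move=> ab bN oab; have aN : (a < N)%N by lia.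
have lN : (b.-1 < N)%N by lia.
pose x := Ordinal aN; pose l := Ordinal lN.
pose add r : {ffun 'I_N -> 'I_N} := [ffun y => if y == x then l else r y].
pose del r : {ffun 'I_N -> 'I_N} := [ffun y => if y == x then x else r y].
have addK r : chain a.+1 b r -> del (add r) = r.
  move=> ch; apply/ffunP => y; rewrite !ffunE; case: (y =P x) => // ->.
  by rewrite (chain_out ch) //=; lia.
have delK r : chain a b r -> add (del r) = r.
  move=> ch; apply/ffunP => y; rewrite !ffunE; case: (y =P x) => // ->.
  by rewrite (chain_odd_last ch (x := x) (y := l)) //=; lia.
have xE : x = a :> nat by [].
have lE : l = b.-1 :> nat by [].
have olx : odd l = odd x by rewrite lE xE; move: ab oab; clear; lia.
have xl : x <> l by move/(congr1 val) => /=; lia.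
(* A separating pair that uses the first point x may use the last point l instead, since both lie
   outside the interval and in one block. *)
have sep_add r (u v : 'I_N) : r l = l -> (forall y, odd (r y) = odd y) ->
    (a < u)%N -> (v < b)%N -> odd u = odd v ->
    separated a b (add r) u v <-> separated a.+1 b r u v.
  move=> rl ro au vb ouv; split=> /separatedP[z [w [uzv wab wuv ozu e]]];
      apply/separatedP; exists z; last first.
    exists w; split=> //; first lia.
    have zx : z <> x by move=> zx; rewrite zx /= in uzv; lia.
    have wx : w <> x by move=> wx; rewrite wx /= in wab; lia.
    by rewrite !ffunE; case: eqP => //; case: eqP.
  have zx : z <> x by move=> zx; rewrite zx /= in uzv; lia.
  move: e; rewrite !ffunE; case: (z =P x) => // _;
    case: (w =P x) => [_ rz|wx rzw].
    have oz : odd z = odd l by rewrite -rz ro.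
    have vl : v <> l by move=> vl; move: ozu; rewrite oz ouv vl eqxx.
    have vl' : v <> l :> nat by move/val_inj.
    by exists l; split=> //; move: vl'; rewrite ?rz ?rl // ?lE; lia_noodd.
  exists w; split=> //; have : w <> x :> nat by move/val_inj.
  by move=> /=; lia.
have ch_del r : chain a b r -> chain a.+1 b (del r).
  move=> ch; have dE y : (a < y)%N -> del r y = r y.
    by rewrite ffunE; case: (y =P x) => // -> /=; rewrite ltnn.
  apply/chainP; split=> [y yab|y yab|u v au uv vb ouv].
  - rewrite !dE; try lia; last by apply: leq_trans (chain_le ch y); lia.
    rewrite (chain_odd ch) (chain_idem ch) (chain_le ch) (chain_lt ch) //; lia.
  - rewrite ffunE; case: (y =P x) => // yx.
    have : y <> x :> nat by move/val_inj.
    by move=> /= ya; rewrite (chain_out ch) //; lia.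
  rewrite -sep_add ?delK //; try lia.
  - by rewrite !dE ?(chain_sep ch) //; lia.
  - by rewrite dE /= ?(chain_last ch) //=; lia.
  - by move=> y; rewrite ffunE; case: (y =P x) => [->|] //;
    rewrite (chain_odd ch).
have ch_add r : chain a.+1 b r -> chain a b (add r).
  move=> ch; have aE y : (a < y)%N -> add r y = r y.
    by rewrite ffunE; case: (y =P x) => // -> /=; rewrite ltnn.
  have rl : r l = l by rewrite (chain_last ch) //=; lia.
  have ax : add r x = l by rewrite ffunE eqxx.
  apply/chainP; split=> [y yab|y yab|u v au uv vb ouv].
  - case: (y =P x) => [->|yx].
      by rewrite ax aE /= ?rl; last lia; split=> //=; lia.
    have : y <> x :> nat by move/val_inj.
    move=> /= ya; rewrite !aE; try lia; last first.
      by apply: leq_trans (chain_le ch y); lia.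
    by rewrite (chain_odd ch) (chain_idem ch) (chain_le ch) (chain_lt ch) //;
      lia.
  - rewrite ffunE; case: (y =P x) => [yx|_]; last by rewrite (chain_out ch) //;
    lia.
    by rewrite yx /= in yab; lia.
  case: (u =P x) => [eu|ux]; last first.
    have : u <> x :> nat by move/val_inj.
    move=> /= ua; rewrite sep_add //; try lia; last exact: (chain_odd ch).
    by rewrite !aE ?(chain_sep ch) //; lia.
  subst u; rewrite ax aE //.
  case: (v =P l) => [->|vl].
    rewrite rl; split=> // _ /separatedP[z [w [/= ? ? ? _ _]]]; lia.
  have : v <> l :> nat by move/val_inj.
  (* As x is joined to l, it is joined to v exactly when v is joined to l; correspondingly, the
     roles of z and w are exchanged: one lies between x and v, the other between v and l. *)
  move=> /= vl'; have sepE :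
    separated a b (add r) x v <-> separated a.+1 b r v l.
    split=> /separatedP[z [w [/= xzv wab xwv ozx e]]]; apply/separatedP;
      exists w, z.
      move: e; rewrite !aE; try lia; move=> e.
      have ow : odd w = odd z by rewrite -(chain_odd ch) -e (chain_odd ch).
      have wl : w <> l :> nat.
        by move=> /val_inj wl; move: ozx; rewrite -ow wl olx eqxx.
      split=> //; first lia_noodd; last by rewrite ow -ouv.
        by rewrite /=; lia_noodd.
      by rewrite lE; lia_noodd.
    have ow : odd w = odd z by rewrite -(chain_odd ch) -e (chain_odd ch).
    split=> //; try by rewrite /=; lia_noodd.
      by rewrite ow ouv.
    by rewrite !aE //; lia_noodd.
  rewrite sepE -(chain_sep ch) //= ?rl; try lia.
  by split=> ->.
rewrite /chain_sum (reindex_onto add del) => /=; last by move=> r /delK.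
apply: eq_big => r.
  apply/idP/idP => [/andP[/ch_del ch /eqP<-//]|ch].
  by rewrite ch_add // addK ?eqxx.
case/andP=> /ch_del ch /eqP e; rewrite {}e in ch.
rewrite /chain_weight; apply: eq_big => y; rewrite !ffunE;
  case: (y =P x) => [->|yx].
- by rewrite ltnn /=; apply/negbTE/negP => /andP[_ /eqP/esym].
- congr (_ && _); have : y <> x :> nat by move/val_inj.
  by rewrite /=; lia.
- by case/andP=> _ /eqP/esym.
case/andP=> yab /eqP ry; congr W; case: (y.+1 =P b) => [yb|yb]; rewrite ?addn0.
  rewrite addnS -addSn; congr addn.
  have -> : y = l by apply/val_inj => /=; lia.
  rewrite (_ : [set z | add r z == l] = x |: [set z | r z == l]).
    rewrite cardsU1 inE (chain_out ch) /= ?ltnSn //.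
    by case: eqP.
  by apply/setP => z; rewrite !inE ffunE; case: (z =P x) => //=; rewrite eqxx.
apply: eq_card => z; rewrite !inE ffunE; case: (z =P x) => // ->.
have -> : r x = x by rewrite (chain_out ch) //= ltnSn.
by apply/eqP/eqP => // e; [case: yb; rewrite -e /=; lia | case: yx].
Qed.

Lemma chain_sum_one k a : (a < N)%N -> chain_sum k a a.+1 = W (odd a) k.+1.
Proof.
move=> aN; pose x := Ordinal aN.
have ch1 : chain a a.+1 [ffun y : 'I_N => y].
  apply/chainP; split=> [y ya|y _|y z]; rewrite ?ffunE //; last lia.
  by split=> //; case/andP: ya.
rewrite /chain_sum (big_pred1 [ffun y => y]); last first.
  move=> r; apply/idP/eqP => [ch|->//]; apply/ffunP => y; rewrite ffunE.
  have [|ya|ya] := ltngtP y a; [| |]; try by move=> *;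
    rewrite (chain_out ch) //; lia.
  by rewrite (chain_last ch) //; lia.
rewrite /chain_weight (big_pred1 x).
  rewrite /= eqxx; congr W;
    rewrite (_ : [set _ | _] = [set x]) ?cards1 ?add1n //.
  by apply/setP => y; rewrite !inE ffunE.
by move=> y; rewrite /= ffunE eqxx andbT -val_eqE /=; lia.
Qed.

End ChainSums.

(** * Generating series of chains of odd length *)

Section OddChains.
Variables (R : comNzRingType) (W : bool -> nat -> R).

(** [O m e k] stands for the sum over chains of 2m-1 points with endpoints of colour e
    ([chain_sum_oddE]). The recursion drops the first point and splits the even chain that remains;
    the value at m = 0 gives the series zero constant term. *)
Lemma odd_chain_sums_exist : exists O : nat -> bool -> nat -> R,
  (forall e k, O 0%N e k = 0) /\
  forall m e k, O m.+1 e k = W e k.+1 *+ (m == 0)%N +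
    \sum_(i < m) O i.+1 (~~ e) 0%N * O (m - i)%N e k.+1.
Proof.
pose F (u : nat -> bool -> nat -> R) j e k := if j is m.+1 then
  W e k.+1 *+ (m == 0)%N + \sum_(i < m) u i.+1 (~~ e) 0%N * u (m - i)%N e k.+1
  else 0.
have [|O eO] := @causal_fixpoint _ F _ (fun _ _ => 0).
  move=> u v [|m] uv //=; apply/funext => e; apply/funext => k.
  by congr (_ + _); apply: eq_bigr => i _; have im := ltn_ord i;
    rewrite !uv //; lia.
by exists O; split=> [e k|m e k]; rewrite eO.
Qed.

Variable O : nat -> bool -> nat -> R.
Hypotheses (O0 : forall e k, O 0%N e k = 0)
  (OS : forall m e k, O m.+1 e k = W e k.+1 *+ (m == 0)%N +
     \sum_(i < m) O i.+1 (~~ e) 0%N * O (m - i)%N e k.+1).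

Lemma big_even_gap N a b m (F : nat -> R) : (b <= N)%N -> b = (a + m.*2)%N ->
  \sum_(i : 'I_N | [&& (a <= i)%N, (i.+1 < b)%N & ~~ odd (i - a)]) F i =
  \sum_(t < m) F (a + t.*2)%N.
Proof.
move=> + eb; rewrite {}eb; case: m => [|m] bN.
  by rewrite big_ord0 big_pred0 // => i; apply/negbTE; lia.
have hN (t : 'I_m.+1) : (a + t.*2 < N)%N by have := ltn_ord t; lia.
rewrite (reindex_onto (fun t => Ordinal (hN t)) (fun i :
  'I_N => inord (i - a)./2)).
  apply: eq_bigl => t /=; have := ltn_ord t; rewrite -val_eqE /= => tm.
  by rewrite inordK; lia.
move=> i /and3P[ai ib oi]; apply/val_inj => /=.
by rewrite inordK; lia.
Qed.

Lemma chain_sum_oddE N m k a : (a + m.*2 < N)%N ->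
  chain_sum W N k a (a + m.*2).+1 = O m.+1 (odd a) k.
Proof.
elim/ltn_ind: m k a => -[|m] IH k a aN.
  by rewrite double0 addn0 chain_sum_one ?OS ?big_ord0 ?addr0 //; lia.
rewrite chain_sum_odd ?chain_sum_even; try lia.
have /= := @big_even_gap N a.+1 (a + m.+1.*2).+1 m.+1 
  (fun i => chain_sum W N 0 a.+1 i.+1 *
            chain_sum W N k.+1 i.+1 (a + m.+1.*2).+1).
move=> -> //; try lia.
rewrite OS mulr0n add0r; apply: eq_bigr => t _; have tm := ltn_ord t.
rewrite IH; try lia; congr (_ * _).
rewrite (_ : (a + m.+1.*2).+1 = ((a.+1 + t.*2).+1 + (m - t).*2).+1); last lia.
rewrite IH; try lia; rewrite subSn; last lia.
by congr (O _ _ _); lia.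
Qed.

Lemma chain_sum_total n :
  chain_sum W n.+1.*2 0 0 n.+1.*2 =
  \sum_(t < n.+1) O t.+1 false 0%N * O (n.+1 - t)%N true 0%N.
Proof.
rewrite chain_sum_even; try lia.
have /= := @big_even_gap n.+1.*2 0 n.+1.*2 n.+1
  (fun i => chain_sum W n.+1.*2 0 0 i.+1 *
            chain_sum W n.+1.*2 0 i.+1 n.+1.*2).
move=> -> //; apply: eq_bigr => t _; have tm := ltn_ord t.
rewrite chain_sum_oddE; try lia; congr (_ * _).
rewrite [X in chain_sum _ _ _ _ X](_ : _ = ((t.*2).+1 + (n - t).*2).+1);
  last lia.
rewrite chain_sum_oddE; try lia.
by rewrite subSn ?add0n /= ?odd_double //; lia.
Qed.

Let Q N e k := trunc N (fun j => O j e k).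

Let Q0 N e k : (Q N e k)`_0 = 0.
Proof. exact: trunc0. Qed.

Lemma odd_series_step N e k :
  eq_upto N (Q N e k) ((W e k.+1)%:P * 'X + Q N (~~ e) 0 * Q N e k.+1).
Proof.
move=> [|m] mN; rewrite coefD coefMX /=.
  by rewrite Q0 add0r coefM big_ord1 Q0 mul0r.
rewrite trunc_coef // OS coefC; congr (_ + _).
  by case: (m == 0)%N; rewrite ?mulr1n.
rewrite coefM big_ord_recl Q0 mul0r add0r big_ord_recr /= /bump leq0n.
rewrite add1n subnn Q0 mulr0 addr0; apply: eq_bigr => i _.
have im := ltn_ord i; rewrite /bump leq0n add1n.
by rewrite !trunc_coef ?subSS //; lia.
Qed.

(** Unrolling the previous equation walks through the block of the endpoints: m+1 elements of that
    block leave m gaps, each filled by an odd chain of the other colour. *)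
Lemma odd_series_iter N e M :
  eq_upto N (Q N e 0)
    (\sum_(m < M) (W e m.+1)%:P * 'X * Q N (~~ e) 0 ^+ m +
     Q N (~~ e) 0 ^+ M * Q N e M).
Proof.
elim: M => [|M IH]; first by rewrite big_ord0 add0r expr0 mul1r.
apply: (eq_upto_trans IH); rewrite big_ord_recr /= -addrA.
apply: eq_uptoD => //.
set A := Q N (~~ e) 0.
rewrite (_ : _ + _ = A ^+ M * ((W e M.+1)%:P * 'X + A * Q N e M.+1)).
  by apply: eq_uptoM => //; apply: odd_series_step.
by rewrite exprS; ring.
Qed.

(** With A the series of colour [~~ e], the unrolled sum times A is z W(A), and the remainder
    vanishes to the given order because A has no constant term. *)
Lemma odd_series_product N e : W e 0%N = 0 ->
  eq_upto N (Q N (~~ e) 0 * Q N e 0) ('X * (trunc N (W e) \Po Q N (~~ e) 0)).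
Proof.
move=> W0; case: N => [//|N].
set A := Q _ (~~ e) 0.
have := eq_uptoM (fun i _ => erefl A`_i) (@odd_series_iter N.+1 e N).
move/eq_upto_trans; apply.
have -> : 'X * (trunc N.+1 (W e) \Po A) =
    A * (\sum_(m < N) (W e m.+1)%:P * 'X * A ^+ m).
  rewrite /trunc poly_def raddf_sum /= big_ord_recl W0 scale0r comp_poly0 add0r.
  rewrite !mulr_sumr; apply: eq_bigr => i _.
  rewrite comp_polyZ comp_Xn_poly -mul_polyC exprS /=; ring.
rewrite mulrDr -[X in eq_upto _ _ X]addr0; apply: eq_uptoD => // i iN.
rewrite mulrA -exprS coef0 coefM big1 // => j _.
by rewrite coef_exp_lt ?mul0r ?Q0 //; have := ltn_ord j; lia.
Qed.

End OddChains.

(** Odd chains supply the two auxiliary series required by [lagrange_product]. *)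
Lemma lagrange_chain_sum (R : comNzRingType) (f g sigma tau : nat -> R) :
    sigma 0%N = 1 -> tau 0%N = 1 -> lagrange_solution sigma f ->
      lagrange_solution tau g ->
  lagrange_solution (cauchy sigma tau) (fun n => if n == 0%N then 0 else
    chain_sum (fun e : bool => if e then g else f) n.*2 0 0 n.*2).
Proof.
move=> s0 t0 lf lg; pose W (e : bool) := if e then g else f.
have [O [O0 OS]] := odd_chain_sums_exist W.
have f1 := lagrange_one s0 lf; have g1 := lagrange_one t0 lg.
have hE := chain_sum_total OS.
apply: (lagrange_product lf lg) => //=.
  rewrite (hE 0%N) big_ord1 !OS !big_ord0 /= !addr0.
  by rewrite /W f1 g1 mulr1.
move=> N; pose Q e := trunc N (fun j => O j e 0%N).
(* The gaps in a block weighted by f, of colour [false], are chains of colour [true], hence the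
   order. Odd chains with 2n points in total have indices adding up to n+1, which is the factor z in
   front of h. *)
exists (Q true), (Q false); split; try exact: trunc0.
- move=> [|[|i]] iN; rewrite coefXM /= coefM.
  + by rewrite big_ord1 trunc_coef ?O0 ?mul0r //.
  + rewrite trunc_coef //=; last lia.
    by rewrite !big_ord_recl big_ord0 /= !trunc_coef ?O0 ?mul0r ?mulr0
      ?addr0 //; lia.
  rewrite trunc_coef /=; last lia.
  rewrite hE -coefM mulrC coefM [RHS]big_ord_recl [X in _ = _ + X]big_ord_recr /=.
  rewrite /bump leq0n subnn !trunc_coef ?O0 ?mul0r ?mulr0 ?addr0 ?add0r //;
    try lia.
  apply: eq_bigr => j _; have ji := ltn_ord j.
  by rewrite /bump leq0n add1n !trunc_coef ?subSS //; lia.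
- exact: (odd_series_product O0 OS (e := false) lf.1).
rewrite mulrC; exact: (odd_series_product O0 OS (e := true) lg.1).
Qed.

(** * Kreweras complements *)

Section Kernels.
Variables (T : finType).
Implicit Types (p q : {set {set T}}).

Lemma eq_pblock_preim (U : eqType) (f : T -> U) x y :
  (pblock (preim_partition f [set: T]) x == pblock (preim_partition f [set:
    T]) y)
  = (f x == f y).
Proof.
have /and3P[/eqP cov triv _] := preim_partitionP f [set: T].
rewrite eq_pblock ?cov ?inE //.
by rewrite pblock_equivalence_partition ?inE // => ? ? ? _ _ _;
  split=> [//|/eqP->].
Qed.

Lemma eq_preim_partition (U U' : eqType) (f : T -> U) (g : T -> U') :
  (forall x y, (f x == f y) = (g x == g y)) ->
  preim_partition f [set: T] = preim_partition g [set: T].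
Proof.
move=> fg; apply: eq_imset => x; apply/setP => y.
by rewrite !inE /= fg.
Qed.

Lemma eq_partition p q : partition p [set: T] -> partition q [set: T] ->
  (forall x y, (pblock p x == pblock p y) = (pblock q x == pblock q y)) ->
    p = q.
Proof.
move=> pP qP pq; rewrite -(preim_partition_pblock pP)
  -(preim_partition_pblock qP).
exact: eq_preim_partition.
Qed.

End Kernels.

Section Noncrossing.
Variable n : nat.
Implicit Types (p q : {set {set 'I_n}}) (i j k l u v : 'I_n).

Lemma mem_partition_block p x : partition p [set: 'I_n] -> pblock p x \in p.
Proof. by move=> /and3P[/eqP cov _ _]; rewrite pblock_mem ?cov ?inE. Qed.

Lemma block_pblock p (U : {set 'I_n}) x : partition p [set: 'I_n] ->
  U \in p -> x \in U -> pblock p x = U.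
Proof. by move=> /and3P[_ triv _]; apply: def_pblock. Qed.

Lemma in_pblock p x y : partition p [set: 'I_n] ->
  (y \in pblock p x) = (pblock p x == pblock p y).
Proof. by move=> /and3P[/eqP cov triv _]; rewrite eq_pblock ?cov ?inE. Qed.

Lemma noncrossingP p : partition p [set: 'I_n] ->
  reflect (forall a b c d : 'I_n, (a < b)%N -> (b < c)%N -> (c < d)%N ->
     pblock p a = pblock p c -> pblock p b = pblock p d ->
     pblock p a = pblock p b)
   (noncrossing p).
Proof.
move=> pP; apply: (iffP idP) => [/'forall_implyP nc a b c d ab bc cd ac bd|nc].
  have /'forall_implyP/(_ _ (mem_partition_block b pP)) :=
    nc _ (mem_partition_block a pP).
  move=> /implyP h; apply/eqP; apply: contraT => /h /negP[].
  apply/'exists_andP; exists a; split; first by rewrite in_pblock.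
  apply/'exists_andP; exists b; split; first by rewrite in_pblock.
  apply/'exists_andP; exists c; split; first by rewrite in_pblock // ac.
  apply/'exists_andP; exists d; split; first by rewrite in_pblock // bd.
  by rewrite ab bc cd.
apply/'forall_implyP => U Up; apply/'forall_implyP => V Vp.
apply/implyP; apply: contra.
case/'exists_andP => a [aU /'exists_andP[b [bV /'exists_andP[c [cU]]]]].
case/'exists_andP => d [dV /and3P[ab bc cd]].
rewrite -(block_pblock pP Up aU) -(block_pblock pP Vp bV).
apply/eqP/(nc a b c d) => //.
  by rewrite (block_pblock pP Up aU) (block_pblock pP Up cU).
by rewrite (block_pblock pP Vp bV) (block_pblock pP Vp dV).
Qed.

Lemma noncrossing_preimP (U : eqType) (f : 'I_n -> U) :
  reflect (forall a b c d : 'I_n, (a < b)%N -> (b < c)%N -> (c < d)%N ->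
     f a = f c -> f b = f d -> f a = f b)
   (noncrossing (preim_partition f [set: 'I_n])).
Proof.
have e x y : (f x = f y) <-> pblock (preim_partition f [set: 'I_n]) x =
    pblock (preim_partition f [set: 'I_n]) y.
  by split=> /eqP; [rewrite -eq_pblock_preim | rewrite eq_pblock_preim] => /eqP.
apply: (iffP (noncrossingP (preim_partitionP _ _))) => nc a b c d ab bc cd.
  by move=> /e ac /e bd; apply/e; apply: (nc a b c d).
by move=> /e ac /e bd; apply/e; apply: (nc a b c d).
Qed.

Lemma finerP p q : partition p [set: 'I_n] -> partition q [set: 'I_n] ->
  reflect (forall x y, pblock q x = pblock q y -> pblock p x = pblock p y)
          (finer q p).
Proof.
move=> pP qP; apply: (iffP idP) => [/'forall_implyP fin x y e|fin].
  have /exists_inP[V Vp /subsetP sV] := fin _ (mem_partition_block x qP).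
  rewrite (block_pblock pP Vp (x := x)); last by apply: sV; rewrite in_pblock.
  rewrite (block_pblock pP Vp (x := y)) //; last by apply: sV;
    rewrite in_pblock // e.
apply/'forall_implyP => U Uq; have /and3P[_ _ q0] := qP.
have /set0Pn[x xU] : U != set0 by apply: contraNneq q0 => <-.
apply/exists_inP; exists (pblock p x); first exact: mem_partition_block.
apply/subsetP => y yU; rewrite in_pblock //; apply/eqP/fin.
by rewrite (block_pblock qP Uq xU) (block_pblock qP Uq yU).
Qed.

End Noncrossing.

Section Kreweras.
Variable n : nat.
Implicit Types (p q : {set {set 'I_n}}) (i j k l u v : 'I_n).

Lemma half_subproof (x : 'I_n.*2) : (x./2 < n)%N.
Proof. by have := ltn_ord x; lia. Qed.
Definition half_ord (x : 'I_n.*2) : 'I_n := Ordinal (half_subproof x).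

Lemma interleave_ordK b : cancel (@interleave_ord n b) half_ord.
Proof. by move=> i; apply/val_inj => /=; case: b; lia. Qed.

Lemma odd_interleave_ord b i : odd (interleave_ord b i) = b.
Proof. by case: b => /=; lia. Qed.

Lemma half_ordK (x : 'I_n.*2) : interleave_ord (odd x) (half_ord x) = x.
Proof. by apply/val_inj => /=; exact: odd_double_half. Qed.

(** With partitions seen as kernels of functions, interleaving amounts to recording the colour along
    with the value. *)
Lemma interleave_preim (U : eqType) (f : bool -> 'I_n -> U) :
  interleave (preim_partition (f false) [set: 'I_n])
             (preim_partition (f true) [set: 'I_n]) =
  preim_partition (fun x : 'I_n.*2 => (odd x, f (odd x) (half_ord x))) [set: _].
Proof.
have blk b i : interleave_ord b @: [set j in [set: 'I_n] | f b i == f b j] =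
    [set y in [set: 'I_n.*2] |
      (b, f b i) == (odd y, f (odd y) (half_ord y))].
  apply/setP => y; rewrite !inE /=; apply/imsetP/eqP.
    case=> j; rewrite !inE /= => /eqP e ->.
    by rewrite odd_interleave_ord interleave_ordK e.
  case=> eb ef; exists (half_ord y); last by rewrite eb half_ordK.
  by rewrite !inE /= ef eb.
apply/setP => V; rewrite inE; apply/orP/imsetP => [[]|[x _ ->]].
- case/imsetP=> U0 /imsetP[i _ ->] ->; exists (interleave_ord false i) => //.
  by rewrite blk odd_interleave_ord interleave_ordK.
- case/imsetP=> U0 /imsetP[i _ ->] ->; exists (interleave_ord true i) => //.
  by rewrite blk odd_interleave_ord interleave_ordK.
rewrite -blk; case: (odd x); [right | left]; apply: imset_f; exact: imset_f.
Qed.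

(** * The Kreweras complement through arcs *)

(* The arcs of [p] passing over the barred point of index [i].                *)
Definition arcs p i : {set 'I_n * 'I_n} :=
  [set a | (pblock p a.1 == pblock p a.2) && (a.1 <= i < a.2)%N].

Lemma arcsE p i u v :
  ((u, v) \in arcs p i) = (pblock p u == pblock p v) && (u <= i < v)%N.
Proof. by rewrite inE. Qed.

Lemma interleaveE p q : partition p [set: 'I_n] -> partition q [set: 'I_n] ->
  interleave p q = preim_partition
    (fun x : 'I_n.*2 => (odd x, pblock (if odd x then q else p) (half_ord x)))
    [set: _].
Proof.
move=> pP qP; rewrite -(interleave_preim (fun b :
  bool => pblock (if b then q else p))).
by rewrite !preim_partition_pblock.
Qed.

(** For i < j < k < l, an arc over i and k is over j, and an arc over j and l is over k, so the
    kernel of [arcs p] is non-crossing. It does not cross p, since an arc of p cannot pass over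
    exactly one of two points with the same arcs. *)
Lemma preim_arcs_candidate p : p \in NC n ->
  preim_partition (arcs p) [set: 'I_n] \in kreweras_candidates p.
Proof.
rewrite inE => /andP[pP pnc]; set q := preim_partition _ _.
have qP : partition q [set: 'I_n] := preim_partitionP _ _.
have qE x y : pblock q x = pblock q y <-> arcs p x = arcs p y.
  by split=> /eqP; [rewrite eq_pblock_preim | rewrite -eq_pblock_preim] => /eqP.
have qnc : noncrossing q.
  apply/noncrossing_preimP => i j k l ij jk kl ik jl.
  apply/setP => -[u v]; apply/idP/idP => uv.
    move: (uv); rewrite ik !arcsE; move: uv; rewrite arcsE; lia.
  have := uv; rewrite jl arcsE; have := uv; rewrite arcsE => uvj uvl.
  have : (u, v) \in arcs p k by rewrite arcsE; lia.
  by rewrite -ik.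
rewrite !in_set qP qnc /= (interleaveE pP qP) preim_partitionP /=.
apply/noncrossing_preimP => a b c d ab bc cd [oac eac] [obd ebd].
have := odd_double_half a; have := odd_double_half b.
have := odd_double_half c; have := odd_double_half d.
have hE (x : 'I_n.*2) : half_ord x = x./2 :> nat by [].
have ncp := noncrossingP pP pnc.
have ncq := noncrossingP qP qnc.
move: eac ebd; rewrite -oac -obd.
case oa: (odd a); case ob: (odd b) => eac ebd;
  rewrite -?oac -?obd ?oa ?ob => hd hc hb ha.
- congr (_, _); apply: (ncq _ _ (half_ord c) (half_ord d)) => //; rewrite !hE;
  lia.
- move/qE: eac => eac.
  have : (half_ord b, half_ord d) \in arcs p (half_ord c).
    by rewrite arcsE ebd eqxx !hE /=; lia.
  by rewrite -eac arcsE !hE; lia.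
- move/qE: ebd => ebd.
  have : (half_ord a, half_ord c) \in arcs p (half_ord b).
    by rewrite arcsE eac eqxx !hE /=; lia.
  by rewrite ebd arcsE !hE; lia.
congr (_, _); apply: (ncp _ _ (half_ord c) (half_ord d)) => //; rewrite !hE;
  lia.
Qed.

(** If r joins two barred points and an arc of p passes over only one of them, the interleaving has
    a crossing. *)
Lemma candidate_finer_arcs p r : p \in NC n -> r \in kreweras_candidates p ->
  finer r (preim_partition (arcs p) [set: 'I_n]).
Proof.
rewrite inE => /andP[pP pnc].
rewrite in_set => /andP[]; rewrite in_set => /andP[rP rnc]; rewrite in_set.
case/andP=> _.
rewrite (interleaveE pP rP) => /noncrossing_preimP inc.
have nox u v i j : (u <= i)%N -> (i < v)%N -> (v <= j)%N ->
    pblock p u = pblock p v -> pblock r i = pblock r j -> False.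
  move=> ui iv vj uv ij.
  have := inc (interleave_ord false u) (interleave_ord true i)
    (interleave_ord false v) (interleave_ord true j).
  rewrite !odd_interleave_ord !interleave_ordK /= uv ij => h.
  suff: false = true by [].
  by apply: (congr1 fst (h _ _ _ erefl erefl)) => /=; lia.
have nox' u v i j : (i < u)%N -> (u <= j)%N -> (j < v)%N ->
    pblock p u = pblock p v -> pblock r i = pblock r j -> False.
  move=> iu uj jv uv ij.
  have := inc (interleave_ord true i) (interleave_ord false u)
    (interleave_ord true j) (interleave_ord false v).
  rewrite !odd_interleave_ord !interleave_ordK /= uv ij => h.
  suff: true = false by [].
  by apply: (congr1 fst (h _ _ _ erefl erefl)) => /=; lia.
apply/finerP => //; first exact: preim_partitionP.
move=> x y exy; apply/eqP; rewrite eq_pblock_preim; apply/eqP.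
wlog xy : x y exy / (x < y)%N.
  by move=> W; have [/W->//|/W->//|/val_inj->//] := ltngtP x y.
apply/setP => -[u v]; rewrite !arcsE; case: eqP => //= uv.
apply/idP/idP => h; apply/negP => h'.
  by apply: (nox u v x y) => //; lia.
by apply: (nox' u v x y) => //; lia.
Qed.

(** The kernel of [arcs p] is a greatest candidate, and refinement is antisymmetric on
    partitions. *)
Lemma kreweras_arcs p : p \in NC n ->
  kreweras p = preim_partition (arcs p) [set: 'I_n].
Proof.
move=> pNC; set q0 := preim_partition _ _.
have q0c := preim_arcs_candidate pNC.
have partc q : q \in kreweras_candidates p -> partition q [set: 'I_n].
  by rewrite in_set => /andP[]; rewrite in_set => /andP[].
rewrite /kreweras; case: pickP => [q /andP[qc /'forall_implyP qmax]|/(_ q0)].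
  have q0q := finerP (partc _ qc) (partc _ q0c) (qmax _ q0c).
  have qq0 := finerP (partc _ q0c) (partc _ qc) (candidate_finer_arcs pNC qc).
  apply: eq_partition; [exact: partc | exact: partc|] => x y.
  by apply/eqP/eqP => [/qq0|/q0q].
rewrite q0c /= => /negP[]; apply/'forall_implyP => r.
exact: candidate_finer_arcs.
Qed.

End Kreweras.

(** * Chains as non-crossing partitions with their complements *)

Section ChainNC.
Variable n : nat.
Implicit Types (p q : {set {set 'I_n}}) (r : {ffun 'I_n.*2 -> 'I_n.*2}).
Implicit Types (i j k l u v : 'I_n) (x y z w : 'I_n.*2).

Definition colour_part (e : bool) r : {set {set 'I_n}} :=
  preim_partition (fun i => r (interleave_ord e i)) [set: 'I_n].

Lemma interleave_ordP x : exists e i, x = interleave_ord e i.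
Proof. by exists (odd x), (half_ord x); rewrite half_ordK. Qed.

Lemma colour_partP e r i j :
  pblock (colour_part e r) i = pblock (colour_part e r) j <->
  r (interleave_ord e i) = r (interleave_ord e j).
Proof.
by split=> /eqP; [rewrite eq_pblock_preim | rewrite
  -(eq_pblock_preim (fun i => r (interleave_ord e i)))] => /eqP.
Qed.

Lemma colour_part_NC e r : chain 0 n.*2 r -> colour_part e r \in NC n.
Proof.
move=> ch; rewrite inE preim_partitionP /=.
apply/noncrossing_preimP => a b c d ab bc cd.
by apply: (chain_noncrossing ch) => //=; move: (ltn_ord d); case: e => /=; lia.
Qed.

(** An unbarred pair separating two barred points is precisely an arc passing over one of them and
    not the other. *)
Lemma separated_arcs r i j : (i < j)%N -> (forall x, odd (r x) = odd x) ->
  separated 0 n.*2 r (interleave_ord true i) (interleave_ord true j) <->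
  arcs (colour_part false r) i <> arcs (colour_part false r) j.
Proof.
move=> ij ro; split.
  case/separatedP=> z [w [ijz _ wij oz zw]] e.
  have ow : odd w = odd z by rewrite -ro -zw ro.
  move: ijz wij oz zw ow.
  have [ez [z' ->]] := interleave_ordP z;
    have [ew [w' ->]] := interleave_ordP w.
  rewrite !odd_interleave_ord; case: ez => // ijz wij _ zw ew0; subst ew.
  move: ijz wij; rewrite /= => ijz wij.
  have zw' : pblock (colour_part false r) z' = pblock (colour_part false r) w'.
    exact/colour_partP.
  case: (ltnP i w') => iw.
    have : (z', w') \in arcs (colour_part false r) j.
      by rewrite arcsE zw' eqxx /=; lia.
    by rewrite -e arcsE zw' eqxx /=; lia.
  have : (w', z') \in arcs (colour_part false r) i.
    by rewrite arcsE zw' eqxx /=; lia.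
  by rewrite e arcsE zw' eqxx /=; lia.
move=> ne; apply/separatedP.
have [[u v] uv] : exists a, (a \in arcs (colour_part false r) i) !=
                            (a \in arcs (colour_part false r) j).
  apply/existsP; apply: contraT; rewrite negb_exists => /forallP h.
  by case: ne; apply/setP => a; apply/eqP; rewrite -[_ == _]negbK.
move: uv; rewrite !arcsE;
  case: (pblock _ u =P pblock _ v) => //= /colour_partP uv h.
have : (u <= i < v)%N && (v <= j)%N || (i < u)%N && (u <= j < v)%N.
  by move: h; case: (_ && _) / idP => h1; case: (_ && _) / idP => h2; lia.
case/orP=> h'.
  exists (interleave_ord false v), (interleave_ord false u).
  by rewrite /= ltn_double ltn_ord; split=> //; lia.
exists (interleave_ord false u), (interleave_ord false v).
by rewrite /= ltn_double ltn_ord; split=> //; lia.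
Qed.

Lemma kreweras_chain r : chain 0 n.*2 r ->
  kreweras (colour_part false r) = colour_part true r.
Proof.
move=> ch; rewrite kreweras_arcs ?colour_part_NC //.
suff key i j : arcs (colour_part false r) i = arcs (colour_part false r) j <->
    r (interleave_ord true i) = r (interleave_ord true j).
  by apply: eq_preim_partition => i j; apply/eqP/eqP => /key.
wlog ij : i j / (i < j)%N.
  move=> W; have [/W->//|/W h|/val_inj->//] := ltngtP i j.
  by split=> e; apply/esym/h.
have ij2 : (interleave_ord true i < interleave_ord true j)%N by rewrite /=; lia.
rewrite (chain_sep ch (leq0n _) ij2 (ltn_ord _)) ?odd_interleave_ord //.
rewrite separated_arcs //; last exact: (chain_odd ch).
by split=> [-> //|/contrapT].
Qed.

(** The even blocks determine the odd ones as their Kreweras complement, and [r] sends a point to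
    the maximum of its block. *)
Lemma chain_determined r r' : chain 0 n.*2 r -> chain 0 n.*2 r' ->
  colour_part false r = colour_part false r' -> r = r'.
Proof.
move=> ch ch' e0.
have e1 : colour_part true r = colour_part true r'.
  by rewrite -!kreweras_chain // e0.
have same x y : r x = r y -> r' x = r' y.
  move=> rxy; have : odd x = odd y by rewrite
    -(chain_odd ch) rxy (chain_odd ch).
  move: rxy; have [ex [i ->]] := interleave_ordP x;
    have [ey [j ->]] := interleave_ordP y.
  rewrite !odd_interleave_ord => + ee; subst ey; move/colour_partP => h.
  by apply/colour_partP; move: h; case: ex; rewrite ?e0 ?e1.
have same' x y : r' x = r' y -> r x = r y.
  move=> rxy; have : odd x = odd y by rewrite
    -(chain_odd ch') rxy (chain_odd ch').
  move: rxy; have [ex [i ->]] := interleave_ordP x;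
    have [ey [j ->]] := interleave_ordP y.
  rewrite !odd_interleave_ord => + ee; subst ey; move/colour_partP => h.
  by apply/colour_partP; move: h; case: ex; rewrite ?e0 ?e1.
apply/ffunP => x; apply/val_inj/eqP; rewrite eqn_leq; apply/andP; split.
  by rewrite -(same _ _ (chain_idem ch x)) (chain_le ch').
by rewrite -(same' _ _ (chain_idem ch' x)) (chain_le ch).
Qed.

(* Two points [i < j] of different blocks are separated by two barred points: *)
(* the one following the last element [i'] before [j] of the block of [i],    *)
(* and the one preceding the next element (cyclically) of that block.         *)
Lemma arcs_separate p i j : p \in NC n -> (i < j)%N ->
  pblock p i <> pblock p j ->
  exists k l, [/\ (i <= k < j)%N,
    (l < i)%N || (j <= l)%N & arcs p k = arcs p l].
Proof.
rewrite inE => /andP[pP /(noncrossingP pP) nc] ij Nij.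
pose i' := [arg max_(u > i | (pblock p u == pblock p i) && (u < j)%N) (u :
  nat)].
have [/eqP i'i i'j i'max] : [/\ pblock p i' == pblock p i, (i' < j)%N &
    forall u, pblock p u = pblock p i -> (u < j)%N -> (u <= i')%N].
  rewrite /i'; case: arg_maxnP => [|u /andP[? ?] h]; first by rewrite eqxx.
  by split=> // v /eqP vi vj; apply: h; rewrite vi.
have ii' : (i <= i')%N by apply: i'max.
have jN := ltn_ord j.
have neq u v : pblock p u <> pblock p v ->
  (u <> v :> nat) by move=> + /val_inj e; rewrite e.
exists i'.
(* If the block of i continues after j, its next element i2 gives l = i2 - 1: no block element lies
   strictly between i' and i2, and an arc over only one of i' and l would cross the block. *)
case: (boolP [exists v : 'I_n, (pblock p v == pblock p i) && (j < v)%N]).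
  case/existsP=> v0 v0P.
  pose i2 := [arg min_(u < v0 | (pblock p u == pblock p i) && (j < u)%N) (u :
    nat)].
  have [/eqP i2i ji2 i2min] : [/\ pblock p i2 == pblock p i, (j < i2)%N &
      forall u, pblock p u = pblock p i -> (j < u)%N -> (i2 <= u)%N].
    rewrite /i2; case: arg_minnP => [//|u /andP[? ?] h].
    by split=> // v /eqP vi vj; apply: h; rewrite vi.
  have lP : (i2.-1 < n)%N by have := ltn_ord i2; lia.
  have gap u : (i' < u)%N -> (u < i2)%N -> pblock p u <> pblock p i.
    move=> i'u ui2 ui; have [uj|ju|/val_inj uj] := ltngtP u j.
    - by have := i'max u ui uj; lia.
    - by have := i2min u ui ju; lia.
    by case: Nij; rewrite -ui uj.
  exists (Ordinal lP); split; [lia | by apply/orP; right => /=; lia |].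
  apply/setP => -[u v]; rewrite !arcsE /=; case: eqP => //= uv.
  apply/idP/idP => h.
    case: (ltnP v i2) => vi2; last lia.
    have Nv := gap v _ vi2; have : (u < i')%N.
      have := neq u i'; rewrite uv i'i => /(_ (Nv _)); lia.
    move=> ui'; case: Nv; first lia.
    by rewrite -uv -i'i; apply: (nc u i' v i2) => //; rewrite ?i'i //; lia.
  case: (leqP u i') => ui'; first lia.
  have Nu : pblock p u <> pblock p i by apply: gap => //; lia.
  have : (i2 < v)%N by have := neq v i2; rewrite -uv i2i => /(_ Nu); lia.
  move=> i2v; case: Nu; rewrite -i'i; apply/esym.
  by apply: (nc i' u i2 v) => //; rewrite ?i'i ?i2i //; lia.
rewrite negb_exists => /forallP noj.
have last u : (i' < u)%N -> pblock p u <> pblock p i.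
  move=> i'u ui; have [uj|ju|/val_inj uj] := ltngtP u j.
  - by have := i'max u ui uj; lia.
  - by have := noj u; rewrite ui eqxx ju.
  by case: Nij; rewrite -ui uj.
pose m := [arg min_(u < i | pblock p u == pblock p i) (u : nat)].
have [/eqP mi mmin] : (pblock p m == pblock p i) /\
    forall u, pblock p u = pblock p i -> (m <= u)%N.
  rewrite /m; case: arg_minnP => [|u ui h]; first by rewrite eqxx.
  by split=> // v /eqP vi; apply: h.
have mi' : (m <= i')%N by apply: mmin.
have mi0 : (m <= i)%N by apply: mmin.
have inside u v : pblock p u = pblock p v -> (u <= i' < v)%N -> (u < m)%N.
  move=> uv h; have Nv : pblock p v <> pblock p i by apply: last; lia.
  have um := neq u m; rewrite uv mi in um; have {}um := um Nv.
  have ui := neq u i'; rewrite uv i'i in ui; have {}ui := ui Nv.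
  case: (ltnP u m) => // mu; case: Nv; rewrite -uv -mi; apply/esym.
  by apply: (nc m u i' v) => //; rewrite ?mi ?i'i //; lia.
(* Otherwise the next element is, cyclically, the minimum m. The barred point before it is m - 1 or,
   when m = 0, the last one, over which no arc passes. *)
case: (posnP m) => [m0|m0].
  have lP : (n.-1 < n)%N by lia.
  exists (Ordinal lP); split; [lia | by apply/orP; right => /=; lia |].
  apply/setP => -[u v]; rewrite !arcsE /=; case: eqP => //= uv.
  apply/idP/idP => h; first by have := inside u v uv h; lia.
  by have := ltn_ord v; lia.
have lP : (m.-1 < n)%N by lia.
exists (Ordinal lP); split; [lia | by apply/orP; left => /=; lia |].
apply/setP => -[u v]; rewrite !arcsE /=; case: eqP => //= uv.
apply/idP/idP => h; first by have := inside u v uv h; lia.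
case: (ltnP i' v) => vi'; first lia.
have Nv : pblock p v <> pblock p i.
  by move=> vi; have := mmin u; rewrite uv => /(_ vi); lia.
have vm := neq v m; rewrite mi in vm; have {}vm := vm Nv.
have vi := neq v i'; rewrite i'i in vi; have {}vi := vi Nv.
case: Nv; rewrite -uv -mi.
have umE : pblock p u = pblock p m.
  by apply: (nc u m v i') => //; rewrite ?mi ?i'i //; lia.
by rewrite umE.
Qed.

(** [r] takes the maximum in each block of p interleaved with the kernel of [arcs p]. For odd points
    the chain condition is [separated_arcs]; for even points, maximality of p relative to its
    complement is [arcs_separate]. *)
Lemma chain_exists p : p \in NC n ->
  exists2 r, chain 0 n.*2 r & colour_part false r = p.
Proof.
move=> pNC; have pP : partition p [set: 'I_n] by move: pNC;
  rewrite inE => /andP[].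
pose q := preim_partition (arcs p) [set: 'I_n].
have qP : partition q [set: 'I_n] := preim_partitionP _ _.
pose cls x := (odd x, pblock (if odd x then q else p) (half_ord x)).
have cls_even i j : cls (interleave_ord false i) = cls
  (interleave_ord false j) <->
    pblock p i = pblock p j.
  by rewrite /cls !odd_interleave_ord !interleave_ordK; split=> [[]|->].
have cls_odd i j : cls (interleave_ord true i) = cls (interleave_ord true j) <->
    arcs p i = arcs p j.
  rewrite /cls !odd_interleave_ord !interleave_ordK; split=> [[]/eqP|/eqP e].
    by rewrite eq_pblock_preim => /eqP.
  by congr (_, _); apply/eqP; rewrite eq_pblock_preim.
have cls_col x y : cls x = cls y -> odd x = odd y by case.
pose r := [ffun x => [arg max_(y > x | cls y == cls x) (y : nat)]].
have rcls x : cls (r x) = cls x.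
  by rewrite ffunE; case: arg_maxnP => // y /eqP.
have rmax x y : cls y = cls x -> (y <= r x)%N.
  by rewrite ffunE; case: arg_maxnP => // z _ h /eqP/h.
have rE x y : r x = r y <-> cls x = cls y.
  split=> [e|e]; first by rewrite -rcls e rcls.
  apply/val_inj/eqP; rewrite eqn_leq; apply/andP; split; apply: rmax;
    rewrite rcls //.
have ro x : odd (r x) = odd x by apply/cls_col/rcls.
have p_r : colour_part false r = p.
  apply: eq_partition => // [|i j]; first exact: preim_partitionP.
  by apply/eqP/eqP => [/colour_partP/rE/cls_even|/cls_even/rE/colour_partP].
exists r => //; apply/chainP; split=> [x _|x|x y _ xy _ oxy].
- split=> //; [exact: rmax | exact/rE].
- by rewrite ltn_ord.
rewrite rE; move: xy oxy.
have [ex [i ->]] := interleave_ordP x; have [ey [j ->]] := interleave_ordP y.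
rewrite !odd_interleave_ord => + ee; subst ey.
case: ex => [/= ij|/= ij].
  rewrite cls_odd separated_arcs // ?p_r; last lia.
  by split=> [-> //|/contrapT].
have {}ij : (i < j)%N by lia.
rewrite cls_even; split=> [Pij /separatedP[z [w [xzy _ wxy oz /rE zw]]]|Nsep].
  have := cls_col _ _ zw; move: xzy wxy oz zw.
  have [ez [k ->]] := interleave_ordP z; have [ew [l ->]] := interleave_ordP w.
  rewrite !odd_interleave_ord; case: ez => //= ikj lij _ + ee; subst ew.
  move/cls_odd => kl; have : (i, j) \in arcs p k by rewrite arcsE Pij eqxx /=;
    lia.
  by rewrite kl arcsE; move: lij => /=; lia.
case: (pselect (pblock p i = pblock p j)) => // Nij; case: Nsep.
have [k [l [ikj lij kl]]] := arcs_separate pNC ij Nij.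
apply/separatedP; exists (interleave_ord true k), (interleave_ord true l).
rewrite !odd_interleave_ord; split=> //.
- by rewrite /=; lia.
- by rewrite ltn_ord.
- by rewrite /=; lia.
exact/rE/cls_odd.
Qed.

(** The blocks of one colour are indexed by their last points, the fixed points of [r]. *)
Lemma colour_part_prod (R : comNzRingType) (e : bool) r (F : nat -> R) :
    chain 0 n.*2 r ->
  \prod_(V in colour_part e r) F #|V| =
  \prod_(y : 'I_n.*2 | (r y == y) && (odd y == e)) F #|[set x | r x == y]|.
Proof.
move=> ch; pose blk y := [set i : 'I_n | r (interleave_ord e i) == y].
have blkP y : r y = y -> odd y = e ->
    [set x | r x == y] = interleave_ord e @: blk y.
  move=> ry oy; apply/setP => x; rewrite inE; apply/eqP/imsetP => [rx|[i + ->]].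
    have ox : odd x = e by rewrite -(chain_odd ch) rx.
    by exists (half_ord x); rewrite ?inE -ox half_ordK // rx.
  by rewrite inE => /eqP.
have -> : colour_part e r = blk @: [set y | (r y == y) && (odd y == e)].
  apply/setP => V; apply/imsetP/imsetP => [[i _ ->]|[y]].
    exists (r (interleave_ord e i)).
      by rewrite inE (chain_idem ch) (chain_odd ch) odd_interleave_ord !eqxx.
    by apply/setP => j; rewrite !inE eq_sym.
  rewrite inE => /andP[/eqP ry /eqP oy] ->; exists (half_ord y) => //.
  by apply/setP => j; rewrite !inE -oy half_ordK oy ry eq_sym.
rewrite big_imset /=; last first.
  move=> y z; rewrite !inE => /andP[/eqP ry /eqP oy] /andP[/eqP rz /eqP oz] yz.
  have : y \in [set x | r x == y] by rewrite inE ry.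
  by rewrite blkP // yz -blkP // inE ry => /eqP.
apply: eq_big => y; first by rewrite inE.
rewrite inE => /andP[/eqP ry /eqP oy].
by rewrite blkP // card_imset //; apply: can_inj (@interleave_ordK n e).
Qed.

(** Taking the even blocks is a bijection from chains onto [NC n], under which the odd blocks form
    the Kreweras complement. *)
Lemma NC_sum_chains (R : comNzRingType) (f g : nat -> R) :
  \sum_(p in NC n) \prod_(V in p) f #|V| * \prod_(V in kreweras p) g #|V| =
  chain_sum (fun e : bool => if e then g else f) n.*2 0 0 n.*2.
Proof.
have -> : NC n = colour_part false @: [set r | chain 0 n.*2 r].
  apply/setP => p; apply/idP/imsetP => [/chain_exists[r ch <-]|[r]].
    by exists r; rewrite ?inE.
  by rewrite inE => ch ->; apply: colour_part_NC.
rewrite big_imset /=; last first.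
  by move=> r r'; rewrite !inE; apply: chain_determined.
apply: eq_big => [r|r]; rewrite inE // => ch.
rewrite kreweras_chain // !colour_part_prod // /chain_weight.
rewrite [RHS](bigID (fun y : 'I_n.*2 => odd y == false)) /=.
congr (_ * _); apply: eq_big => y; rewrite ?ltn_ord //=.
- by case/andP=> _ /eqP->; rewrite if_same addn0.
- by rewrite eqbF_neg negbK eqb_id.
by case/andP=> _ /eqP->; rewrite if_same addn0.
Qed.

End ChainNC.

(** * The univariate group and the non-commutative case *)

Section Univariate.
Variable R : comNzRingType.
Implicit Types (f g : Gplus 1 R).

Definition univariate f (n : nat) : R := f (nseq n ord0).

Lemma word1 (w : seq 'I_1) : w = nseq (size w) ord0.
Proof. by elim: w => //= i w {1}->; rewrite (ord1 i). Qed.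

Lemma univariate0 f : univariate f 0 = 0.
Proof. exact: Gcoef_nil. Qed.

Lemma univariate1 f : univariate f 1 = 1.
Proof. exact: Gcoef_letter. Qed.

Lemma univariate_inj f g : univariate f =1 univariate g -> f = g.
Proof. by move=> fg; apply: Gplus_eq => w; rewrite (word1 w); apply: fg. Qed.

Lemma univariate_surj (u : nat -> R) : u 0%N = 0 -> u 1%N = 1 ->
  exists f, univariate f =1 u.
Proof.
move=> u0 u1.
exists (@MkGplus 1 R (fun w => u (size w)) u0 (fun _ => u1)) => n.
by rewrite /univariate /= size_nseq.
Qed.

Lemma coef_part_univariate f (w : seq 'I_1) (p : {set {set 'I_(size w)}}) :
  coef_part f p = \prod_(V in p) univariate f #|V|.
Proof.
apply: eq_bigr => V _.
by rewrite (word1 (subword V)) /subword size_map -cardE.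
Qed.

Lemma univariate_boxtimes f g n : univariate (boxtimes f g) n =
  if n == 0%N then 0 else
    chain_sum (fun e : bool => if e then univariate g else univariate f) n.*2 0 0 n.*2.
Proof.
rewrite /univariate -[in RHS](size_nseq n (ord0 :
  'I_1)) -/(univariate f) -/(univariate g).
rewrite -NC_sum_chains; case: (nseq n ord0) => [//|i w] /=.
by apply: eq_bigr => p _; rewrite !coef_part_univariate.
Qed.

(** alpha lists the coefficients of sigma'/sigma, where f = z sigma(f). A relation is convenient
    since sigma is only known through its existence and uniqueness. *)
Definition log_coordinates (alpha : nat -> R) f :=
  exists2 sigma, log_derivative alpha sigma &
    lagrange_solution sigma (univariate f).

Lemma log_coordinatesD alpha beta f g :
  log_coordinates alpha f -> log_coordinates beta g ->
  log_coordinates (add_seq alpha beta) (boxtimes f g).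
Proof.
move=> [sigma hs lf] [tau ht lg]; exists (cauchy sigma tau).
  exact: log_derivativeD.
rewrite (funext (univariate_boxtimes f g)).
by apply: lagrange_chain_sum => //; [case: hs | case: ht].
Qed.

(** [log_coordinates] is total and single-valued in both directions, so choice extracts two mutually
    inverse maps. *)
Lemma log_coordinates_iso : (forall n, exists c : R, c *+ n.+1 = 1) ->
  exists phi : (nat -> R) -> Gplus 1 R,
    group_isomorphism (@add_seq R) (@boxtimes 1 R) phi.
Proof.
move=> hQ.
have total alpha : exists f, log_coordinates alpha f.
  have [sigma hs] := log_derivative_exists alpha hQ.
  have [u lu] := lagrange_exists sigma.
  have [f fu] := univariate_surj lu.1 (lagrange_one hs.1 lu).
  by exists f, sigma => //; rewrite (funext fu).
have onto f : exists alpha, log_coordinates alpha f.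
  have [sigma s0 lf] := lagrange_symbol_exists (univariate0 f) (univariate1 f).
  by have [alpha ha] := log_exists s0; exists alpha, sigma.
have functional alpha f g :
    log_coordinates alpha f -> log_coordinates alpha g -> f = g.
  move=> [sigma hs lf] [tau ht lg].
  have st := funext (log_derivative_unique hQ hs ht); subst tau.
  exact/univariate_inj/(lagrange_unique lf lg).
have injective alpha beta f :
    log_coordinates alpha f -> log_coordinates beta f -> alpha = beta.
  move=> [sigma hs lf] [tau ht lg].
  have st := funext (lagrange_symbol_unique (univariate0 f)
    (univariate1 f) lf lg).
  by subst tau; apply/funext/(log_unique hs ht).
have [phi phiP] := choice total; have [psi psiP] := choice onto.
exists phi; split; last first.
  by move=> alpha beta; apply: functional (phiP _) (log_coordinatesD _ _).
exists psi => [alpha|f]; first exact: injective (psiP _) (phiP _).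
exact: functional (phiP _) (psiP _).
Qed.

End Univariate.

Lemma comNzRing_of_nontrivial (R : comPzRingType) : (1 : R) <> 0 ->
  exists R' : comNzRingType, (R' : comPzRingType) = R.
Proof.
move/eqP => R1; pose nontrivial := GRing.PzSemiRing_isNonZero.Build R R1.
pose R' : comNzRingType := HB.pack (R : Type) nontrivial R.
by exists R'; rewrite /R' /=; case: R R1 @nontrivial @R' => T c *.
Qed.

(** Over the zero ring both groups are trivial; any other ring is a [comNzRingType], where the
    polynomial arguments apply. *)
Lemma univariate_group_iso (R : comPzRingType) :
    (forall n, exists c : R, c *+ n.+1 = 1) ->
  exists phi : (nat -> R) -> Gplus 1 R,
    group_isomorphism (@add_seq R) (@boxtimes 1 R) phi.
Proof.
have [R0 _|/comNzRing_of_nontrivial[R' <-]] := pselect ((1 : R) = 0);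
  last first.
  exact: log_coordinates_iso.
have all0 (x : R) : x = 0 by rewrite -[x]mulr1 R0 mulr0.
pose f0 := @MkGplus 1 R (fun _ => 0) erefl (fun _ => esym R0).
have Gall f g : f = g :> Gplus 1 R.
  by apply: Gplus_eq => w; rewrite (all0 (f w)) (all0 (g w)).
exists (fun _ => f0); split; last by move=> a b; apply: Gall.
exists (fun _ _ => 0) => [a|g]; last exact: Gall.
by apply/funext => i; rewrite [RHS]all0.
Qed.

(** * The coefficient of xyx *)

Section Noncommutativity.
Variable R : comNzRingType.

Lemma uniq_map_inj (T U : eqType) (h : T -> U) (s : seq T) x y :
  uniq (map h s) -> x \in s -> y \in s -> h x = h y -> x = y.
Proof.
elim: s => //= z s IH /andP[zs us]; rewrite !inE.
move=> /predU1P[->|xs] /predU1P[->|ys] // hxy; last exact: IH.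
  by move: zs; rewrite hxy map_f.
by move: zs; rewrite -hxy map_f.
Qed.

(** The first, middle and last positions in the word xyx. *)
Let o : 'I_3 := @Ordinal 3 0 isT.
Let m : 'I_3 := @Ordinal 3 1 isT.
Let l : 'I_3 := @Ordinal 3 2 isT.

Let ord3P (i : 'I_3) : [\/ i = o, i = m | i = l].
Proof.
case: i => [[|[|[|//]]]] lt3.
- by apply: Or31; apply/val_inj.
- by apply: Or32; apply/val_inj.
by apply: Or33; apply/val_inj.
Qed.

Let split_off (c : 'I_3) := preim_partition (fun i => i == c) [set: 'I_3].

Lemma split_offE c : split_off c = [set [set c]; ~: [set c]].
Proof.
apply/setP => V; rewrite !inE; apply/imsetP/orP => [[i _ ->]|[/eqP->|/eqP->]].
- case: (eqVneq i c) => ic; [left|right]; apply/eqP/setP => j; rewrite !inE /=.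
    by case: (j == c).
  by case: (j == c).
- by exists c => //; apply/setP => j; rewrite !inE /= eqxx; case: (j == c).
have [d dc] : exists d, d != c.
  by case: (ord3P c) => ->; [exists m | exists o | exists o].
exists d => //; apply/setP => j; rewrite !inE /=.
by rewrite (negbTE dc); case: (j == c).
Qed.

Lemma split_off_NC c : split_off c \in NC 3.
Proof. by rewrite inE preim_partitionP noncrossing_small. Qed.

(** The only arc of this partition joins the first two positions, and it passes over the first
    barred point alone. *)
Lemma kreweras_split_last : kreweras (split_off l) = split_off o.
Proof.
rewrite kreweras_arcs ?split_off_NC //; apply: eq_preim_partition => i j.
have e k a : (a \in arcs (split_off l) k) = (k == o) && (a == (o, m)).
  case: a => u v; rewrite arcsE eq_pblock_preim.
  by case: (ord3P k) => ->; case: (ord3P u) => ->; case: (ord3P v) => ->.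
apply/eqP/eqP => [eij|eij].
  by have := e i (o, m); rewrite eij e !eqxx !andbT.
by apply/setP => a; rewrite !e eij.
Qed.

Variables (s : nat) (x y : 'I_s).
Hypothesis xy : x != y.

Lemma coef_part_split (F : coefs s R) c : coef_part F (w := [:: x; y;
  x]) (split_off c) =
  F (@subword s [:: x; y; x] [set c]) * F (@subword s [:: x; y;
    x] (~: [set c])).
Proof.
rewrite /coef_part split_offE big_setU1 ?big_set1 // inE.
apply/eqP => /setP/(_ c); by rewrite !inE eqxx.
Qed.

(** The block containing both ends of xyx reads a word in which x is repeated. *)
Lemma coef_part_repeated (F : coefs s R) (p : {set {set 'I_3}}) :
    (forall w, ~~ uniq w -> F w = 0) -> p \in NC 3 ->
    pblock p o = pblock p l -> coef_part F (w := [:: x; y; x]) p = 0.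
Proof.
move=> F0; rewrite inE => /andP[pP _] ol.
rewrite /coef_part (bigD1 (pblock p o)) /=; last exact: mem_partition_block.
rewrite F0 ?mul0r //; apply/negP => /uniq_map_inj h.
have : o = l; last by [].
by apply: h; rewrite ?mem_enum ?in_pblock ?ol.
Qed.

(** A term survives only if neither p nor its complement joins the two occurrences of x, which
    leaves the partition that isolates the last letter. *)
Lemma boxconv_xyx (F G : coefs s R) :
    (forall w, ~~ uniq w -> F w = 0) -> (forall w, ~~ uniq w -> G w = 0) ->
  boxconv F G [:: x; y; x] = F [:: x] * F [:: x; y] * (G [:: x] * G [:: y; x]).
Proof.
move=> F0 G0; transitivity (\sum_(p in NC 3) coef_part F (w := [:: x; y; x]) p *
  coef_part G (w := [:: x; y; x]) (kreweras p)); first by [].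
rewrite (bigD1 (split_off l)) ?split_off_NC //= big1 ?addr0.
  rewrite kreweras_split_last !coef_part_split.
  by congr (F _ * F _ * (G _ * G _));
    rewrite /subword /enum_mem -enumT !enum_ordSl enum_ord0 /= !inE.
move=> p /andP[pNC pl]; have := pNC; rewrite inE => /andP[pP _].
have [ol|ol] := eqVneq (pblock p o) (pblock p l).
  by rewrite coef_part_repeated ?mul0r.
have KE i j : (pblock (kreweras p) i == pblock (kreweras p) j) =
    (arcs p i == arcs p j).
  by rewrite kreweras_arcs ?eq_pblock_preim.
have KNC : kreweras p \in NC 3.
  by rewrite kreweras_arcs // inE preim_partitionP noncrossing_small.
have [kol|kol] := eqVneq (arcs p o) (arcs p l).
  by rewrite mulrC coef_part_repeated ?mul0r //; apply/eqP; rewrite KE kol.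
(* If p isolated the first position, no arc would pass over the first barred point, nor over the
   last one, and the complement would join them. *)
have om : pblock p o = pblock p m.
  apply/eqP; apply: contraNT kol => om; apply/eqP/setP => -[u v].
  rewrite !arcsE; case: (ord3P u) => ->; case: (ord3P v) => ->;
    by rewrite ?(negbTE om) ?(negbTE ol) ?andbF.
case/eqP: pl; apply: eq_partition => // [|i j]; first exact: preim_partitionP.
rewrite eq_pblock_preim.
by case: (ord3P i) => ->; case: (ord3P j) => ->;
  rewrite -?om ?eqxx ?(negbTE ol) // eq_sym (negbTE ol).
Qed.

Definition letters_and (v w : seq 'I_s) : R :=
  ((size w == 1%N) || (w == v))%:R.

Definition Gletters (a b : 'I_s) : Gplus s R :=
  @MkGplus s R (letters_and [:: a; b]) erefl (fun _ => erefl).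

(** The coefficient of xyx is a product containing f_xy g_yx, equal to 1 in one order and to 0 in
    the other. *)
Lemma boxtimes_not_comm :
  boxtimes (Gletters x y) (Gletters y x) <> boxtimes (Gletters y x)
    (Gletters x y).
Proof.
have supp a b : a != b -> forall w, ~~ uniq w -> Gletters a b w = 0.
  move=> ab w; rewrite /= /letters_and; case: eqP => [|_].
    by case: w => [|c [|]].
  by case: eqP => //= ->; rewrite /= inE ab.
move=> /(congr1 (fun h : Gplus s R => h [:: x; y; x])).
rewrite [LHS]boxconv_xyx ?[RHS]boxconv_xyx; try by apply: supp;
  rewrite // eq_sym.
rewrite /= /letters_and /= !eqxx !mulr1 !eqseq_cons
  (negbTE xy) /= !mulr0 !mul0r.
by move/eqP; rewrite oner_eq0.
Qed.

End Noncommutativity.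

Theorem theorem6p18 :
  (forall R : comAlgebra rat,
     exists phi : (nat -> R) -> Gplus 1 R,
       group_isomorphism (@add_seq R) (@boxtimes 1 R) phi) /\
  (forall (k : comNzRingType) (s : nat), (2 <= s)%N ->
     ~ (exists eta : forall A : comAlgebra k, (nat -> A) -> Gplus s A,
          functor_isomorphism eta) /\
     ~ (forall (A : comAlgebra k) (f g : Gplus s A),
          boxtimes f g = boxtimes g f)).
Proof.
split=> [R|k s s2].
  apply: univariate_group_iso => n; exists (alg_struct R (n.+1%:R^-1)).
  by rewrite -rmorphMn -mulr_natr mulVf ?rmorph1 // Num.Theory.pnatr_eq0.
(* The algebra k over itself already separates the two functors. *)
pose A := @ComAlgebra k k idfun.
have noncomm : ~ (forall f g : Gplus s A, boxtimes f g = boxtimes g f).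
  pose x := Ordinal (ltnW s2); pose y := Ordinal s2.
  by move/(_ (Gletters k x y) (Gletters k y x)); apply: boxtimes_not_comm.
split=> [[eta [iso _]]|comm]; apply: noncomm => f g; last exact: comm.
have [[inv _ invK] morph] := iso A.
(* Commutativity of addition is transported along the isomorphism. *)
rewrite -(invK f) -(invK g) -!morph; congr (eta A _).
by apply/funext => i; rewrite /add_seq addrC.
Qed.
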